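(* Let $f(x)=\frac12 x^TQx+p^Tx+r$ be a quadratic function on $\mathbb{R}^d$ with $Q$ symmetric positive definite, with smallest eigenvalue $\mu$ and largest eigenvalue $L$, $0<\mu<L$. Assume that the parameters $\alpha>0,\ \beta\ge 0,\ \nu\ge 0$ are such that $\rho(A_Q)<1$. For $\lambda>0$ let $$b_\lambda:=\alpha\lambda(1+\nu)-(1+\beta),\qquad c_\lambda:=\beta-\alpha\lambda\nu,$$ $$r_\lambda:=\begin{cases}|1-c_\lambda|\sqrt{1-\frac{b_\lambda^2}{4c_\lambda}} & \text{if } c_\lambda>0 \text{ and } \frac{|b_\lambda|(1+c_\lambda)}{4c_\lambda}<1,\\ \big||1+c_\lambda|-|b_\lambda|\big| & \text{otherwise.}\end{cases}$$ Then the worst-case robustness of the GMM algorithm is $$L_{2,*}=H_\infty=\frac{\alpha}{\sqrt2}\max_{\lambda\in\{\mu,L\}}\frac{\sqrt\lambda}{r_\lambda}.$$ Furthermore, $L_{2,*}=H_\infty\ge\frac{1}{\sqrt{2\mu}}$, and the best robustness level $L_{2,*}=H_\infty=\frac{1}{\sqrt{2\mu}}$ is achieved if and only if $(\alpha,\beta,\nu)\in\mathcal{S}_1\cap\mathcal{S}_2$, where $$\mathcal{S}_1:=\{(\alpha,\beta,\nu): c_\mu\le 0 \text{ or } |b_\mu(1+c_\mu)|\ge 4|c_\mu|\},\qquad \mathcal{S}_2:=\{(\alpha,\beta,\nu):\alpha\sqrt{L\mu}\le r_L\}.$$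
   Context: Generalized momentum method (GMM) with gradient errors $w_k\in\mathbb{R}^d$ and parameters $(\alpha,\beta,\nu)$: starting from $x_0=x_{-1}\in\mathbb{R}^d$, $$x_{k+1}=x_k-\alpha(\nabla f(y_k)+w_k)+\beta(x_k-x_{k-1}),\qquad y_k=x_k+\nu(x_k-x_{k-1}),\quad k\ge 0.$$ Let $x_*$ be the minimizer of $f$. $\ell_2$ gain (worst-case robustness): $L_{2,*}$ is the infimum of all $\gamma>0$ for which there is a function $\overline H:\mathbb{R}^d\to[0,\infty)$, independent of the error sequence, with $\overline H(x_* )=0$, such that for every initialization $x_0=x_{-1}\in\mathbb{R}^d$ and every square-summable $\{w_k\}_{k\ge0}\subset\mathbb{R}^d$, $$\sum_{k\ge0}(f(x_k)-f(x_* ))\le\gamma^2\sum_{k\ge0}\|w_k\|^2+\overline H(x_0).$$ Matrices: with $Q=U\Lambda U^T$ an orthogonal eigendecomposition (eigenvalues in increasing order), $$A_Q=\begin{bmatrix}(1+\beta)I_d-\alpha(1+\nu)Q & -\beta I_d+\alpha\nu Q\\ I_d & 0_d\end{bmatrix},\quad B=\begin{bmatrix}-\alpha I_d\\0_d\end{bmatrix},\quad T=\begin{bmatrix}\tfrac{1}{\sqrt2}\Lambda^{1/2}U^T & 0_d\end{bmatrix}.$$ $\rho(\cdot)$ is the spectral radius and $\|\cdot\|$ the spectral norm. The $H_\infty$ norm (for $\rho(A_Q)<1$) is $H_\infty:=\max_{z\in\mathbb{C},|z|=1}\|G(z)\|$ with $G(z):=T(zI-A_Q)^{-1}B$. *)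

(* Defs.v *)
From HB Require Import structures.
From mathcomp Require Import all_boot all_order all_algebra complex.
From mathcomp Require Import all_classical all_reals all_analysis.

Set Implicit Arguments.
Unset Strict Implicit.
Unset Printing Implicit Defensive.

Import Order.TTheory GRing.Theory Num.Theory.
Import numFieldNormedType.Exports.

Local Open Scope classical_set_scope.
Local Open Scope ring_scope.

(* The library norm on matrices is the sup norm, so Euclidean norms are
   defined here; [Normc.normc] is the complex modulus with values in [R]. *)
Definition l2norm (R : realType) n (v : 'cV[R]_n) : R :=
  Num.sqrt (\sum_i v i 0 ^+ 2).

Definition l2normC (R : realType) n (v : 'cV[R[i]]_n) : R :=
  Num.sqrt (\sum_i Normc.normc (v i 0) ^+ 2).

Definition spectral_norm (R : realType) m n (M : 'M[R[i]]_(m, n)) : R :=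
  sup [set l2normC (M *m v) | v in [set v : 'cV[R[i]]_n | l2normC v <= 1]].

Definition toC (R : realType) m n (M : 'M[R]_(m, n)) : 'M[R[i]]_(m, n) :=
  map_mx (real_complex R) M.

Definition spectral_radius (R : realType) n (A : 'M[R]_n) : R :=
  sup [set Normc.normc z | z in [set z : R[i] | eigenvalue (toC A) z]].

Definition is_max (R : realType) (S : set R) (m : R) : Prop :=
  S m /\ ubound S m.

Definition posdefmx (R : realType) n (Q : 'M[R]_n) : Prop :=
  forall x : 'cV[R]_n, x != 0 -> 0 < (x^T *m Q *m x) 0 0.

Definition smallest_eigenvalue (R : realType) n (Q : 'M[R]_n) (mu : R) : Prop :=
  eigenvalue Q mu /\ forall a, eigenvalue Q a -> mu <= a.

Definition largest_eigenvalue (R : realType) n (Q : 'M[R]_n) (L : R) : Prop :=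
  eigenvalue Q L /\ forall a, eigenvalue Q a -> a <= L.

Definition orthogonal_eigendecomposition (R : realType) n
    (Q U : 'M[R]_n) (Lam : 'rV[R]_n) : Prop :=
  [/\ U^T *m U = 1%:M,
      Q = U *m diag_mx Lam *m U^T &
      forall i j : 'I_n, (i <= j)%N -> Lam 0 i <= Lam 0 j].

Definition quadratic (R : realType) d (Q : 'M[R]_d) (p : 'cV[R]_d) (r : R)
    (x : 'cV[R]_d) : R :=
  2^-1 * (x^T *m Q *m x) 0 0 + (p^T *m x) 0 0 + r.

Definition gradient (R : realType) d (f : 'cV[R]_d -> R) (x : 'cV[R]_d)
    : 'cV[R]_d :=
  \col_i 'D_(delta_mx i 0) f x.

Section GMM.
Variables (R : realType) (d : nat) (f : 'cV[R]_d -> R) (alpha beta nu : R).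

(* the pair (x_k, x_{k-1}), started at x_0 = x_{-1} *)
Fixpoint gmm_state (w : nat -> 'cV[R]_d) (x0 : 'cV[R]_d) (k : nat)
    : 'cV[R]_d * 'cV[R]_d :=
  if k is k'.+1 then
    let: (x, xprev) := gmm_state w x0 k' in
    let y := x + nu *: (x - xprev) in
    (x - alpha *: (gradient f y + w k') + beta *: (x - xprev), x)
  else (x0, x0).

Definition gmm (w : nat -> 'cV[R]_d) (x0 : 'cV[R]_d) (k : nat) : 'cV[R]_d :=
  (gmm_state w x0 k).1.

Definition square_summable (w : nat -> 'cV[R]_d) : Prop :=
  (\sum_(0 <= k <oo) (l2norm (w k) ^+ 2)%:E < +oo)%E.

Definition l2_gain_bound (xs : 'cV[R]_d) (gamma : R) : Prop :=
  exists Hbar : 'cV[R]_d -> R,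
    [/\ forall x, 0 <= Hbar x,
        Hbar xs = 0 &
        forall (x0 : 'cV[R]_d) (w : nat -> 'cV[R]_d), square_summable w ->
          (\sum_(0 <= k <oo) (f (gmm w x0 k) - f xs)%:E <=
           (gamma ^+ 2)%:E * \sum_(0 <= k <oo) (l2norm (w k) ^+ 2)%:E
             + (Hbar x0)%:E)%E].

(* +oo when no gamma is admissible *)
Definition l2_gain (xs : 'cV[R]_d) : \bar R :=
  ereal_inf [set gamma%:E | gamma in
    [set gamma : R | 0 < gamma /\ l2_gain_bound xs gamma]].

End GMM.

Section TransferFunction.
Variables (R : realType) (d : nat).

Definition A_mx (Q : 'M[R]_d) (alpha beta nu : R) : 'M[R]_(d + d) :=
  block_mx ((1 + beta)%:M - (alpha * (1 + nu)) *: Q)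
           (- beta%:M + (alpha * nu) *: Q)
           1%:M 0.

Definition B_mx (alpha : R) : 'M[R]_(d + d, d) :=
  col_mx (- alpha%:M) 0.

Definition T_mx (U : 'M[R]_d) (Lam : 'rV[R]_d) : 'M[R]_(d, d + d) :=
  row_mx ((Num.sqrt 2)^-1 *: (diag_mx (map_mx Num.sqrt Lam) *m U^T)) 0.

Definition transfer (Q U : 'M[R]_d) (Lam : 'rV[R]_d) (alpha beta nu : R)
    (z : R[i]) : 'M[R[i]]_d :=
  toC (T_mx U Lam) *m invmx (z%:M - toC (A_mx Q alpha beta nu))
    *m toC (B_mx alpha).

Definition frequency_gains (Q U : 'M[R]_d) (Lam : 'rV[R]_d)
    (alpha beta nu : R) : set R :=
  [set spectral_norm (transfer Q U Lam alpha beta nu z) |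
    z in [set z : R[i] | Normc.normc z = 1]].

Definition Hinf (Q U : 'M[R]_d) (Lam : 'rV[R]_d) (alpha beta nu : R) : R :=
  sup (frequency_gains Q U Lam alpha beta nu).

End TransferFunction.

Section Levels.
Variable R : realType.

Definition b_lam (alpha beta nu lam : R) : R :=
  alpha * lam * (1 + nu) - (1 + beta).

Definition c_lam (alpha beta nu lam : R) : R := beta - alpha * lam * nu.

Definition r_lam (alpha beta nu lam : R) : R :=
  let b := b_lam alpha beta nu lam in
  let c := c_lam alpha beta nu lam in
  if (0 < c) && (`|b| * (1 + c) / (4 * c) < 1)
  then `|1 - c| * Num.sqrt (1 - b ^+ 2 / (4 * c))
  else `| `|1 + c| - `|b| |.

Definition S1 (mu : R) : set (R * R * R) :=
  [set t | let: (alpha, beta, nu) := t in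
    let b := b_lam alpha beta nu mu in
    let c := c_lam alpha beta nu mu in
    c <= 0 \/ 4 * `|c| <= `|b * (1 + c)|].

Definition S2 (mu L : R) : set (R * R * R) :=
  [set t | let: (alpha, beta, nu) := t in
    alpha * Num.sqrt (L * mu) <= r_lam alpha beta nu L].

End Levels.

(* Main.v *)
Require Import Defs.
From HB Require Import structures.
From mathcomp Require Import all_boot all_order all_algebra complex.
From mathcomp Require Import all_classical all_reals all_analysis.
From mathcomp Require Import ring lra zify.

Import Order.TTheory GRing.Theory Num.Theory.
Import numFieldNormedType.Exports.

Set Implicit Arguments.
Unset Strict Implicit.
Unset Printing Implicit Defensive.

Local Open Scope classical_set_scope.
Local Open Scope ring_scope.

(** In the eigenbasis of Q, and centred at the minimizer, the method splits into
    scalar recursions u_{k+1} + b u_k + c u_{k-1} = - alpha w_k, one for each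
    eigenvalue lam, with b = b_lam and c = c_lam; their characteristic
    polynomial is chi(z) = z^2 + b z + c. Correspondingly the transfer matrix is
    a diagonal matrix with entries of modulus alpha sqrt(lam/2) / |chi(z)|,
    times a unitary matrix ([transferE]), so its norm is the largest of these
    moduli. On the unit circle |chi(z)|^2 is a quadratic polynomial in
    t = Re z, and r_lam^2 is its minimum over [-1, 1] ([char_min_modulus_le],
    [char_min_modulus_attained]). Hence the H-infinity norm is the largest
    value of [peak_gain] over the spectrum of Q.

    That only the two extreme eigenvalues matter is not visible frequency by
    frequency: for fixed z, |chi(z)|^2 / lam is convex in lam and can be small in
    the middle of the spectrum. Instead the frequency moves with lam. With
    x = alpha lam and s = 1 - t, every point (x, s) lies on a curve w |-> s(w),
    either s(w) = k w or 2 s(w) = w + eta (1 - c(w)), along which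
    |chi|^2 / w is nondecreasing or quasi-concave, and therefore takes at one
    end a value at most the one at x ([scaled_modulus2_min_endpoint]).

    The l2 gain is bounded above by a storage function. Spectral factorization
    writes |chi|^2 - r^2 as |a0 z^2 + a1 z + a2|^2 on the circle; in the time
    domain this says that (u_{k+1} + b u_k + c u_{k-1})^2 - r^2 u_k^2 is a square
    plus the increment of a quadratic form in (u_k, u_{k-1}), which the Schur
    conditions make nonnegative ([storage_function]). Summation gives the gain
    inequality, with the initial storage as the function of x_0. Conversely, the
    sequence z^k cut off to finitely many k is the trajectory, started at the
    minimizer, of a finitely supported error; as its length grows the two cut-off
    ends become negligible and the ratio of output to input energy tends to the
    squared gain at frequency z ([gain_ge_frequency]).

    Finally chi(1) = alpha mu for lam = mu, so r_mu <= alpha mu, which is the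
    bound by 1/sqrt(2 mu). Equality holds when the minimum over t is attained at
    t = 1, that is, when the vertex is not interior (S_1) and b_mu <= 0; the
    latter sign is forced by S_2. *)

Local Notation normc := Normc.normc.
Local Notation "x %:C" := (real_complex _ x).

(** * The minimal modulus of a real quadratic on the unit circle *)

(** |z^2 + b z + c|^2 at the point of the unit circle with real part t. *)
Definition char_modulus2 (R : realFieldType) (b c t : R) : R :=
  4 * c * t ^+ 2 + 2 * b * (1 + c) * t + b ^+ 2 + (1 - c) ^+ 2.

(** The formula of [r_lam], with the coefficients b and c as variables. *)
Definition char_min_modulus (R : rcfType) (b c : R) : R :=
  if (0 < c) && (`|b| * (1 + c) / (4 * c) < 1)
  then `|1 - c| * Num.sqrt (1 - b ^+ 2 / (4 * c))
  else `| `|1 + c| - `|b| |.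

(** The Schur conditions: the roots of z^2 + bz + c lie in the open unit disk. *)
Definition schur (R : realFieldType) (b c : R) : Prop :=
  [/\ -1 < c, c < 1, - (1 + c) < b & b < 1 + c].

Section MinModulus.
Variables (R : rcfType) (b c : R).

Lemma schur_normb : schur b c -> `|b| < 1 + c.
Proof. by case=> _ _ b1 b2; rewrite ltr_norml b1. Qed.

Lemma interior_vertexE : 0 < c ->
  (`|b| * (1 + c) / (4 * c) < 1) = (`|b| * (1 + c) < 4 * c).
Proof. by move=> c0; rewrite ltr_pdivrMr ?mul1r//; lra. Qed.

Lemma discriminant_lt0 : schur b c -> 0 < c -> `|b| * (1 + c) < 4 * c -> b ^+ 2 < 4 * c.
Proof.
move=> S c0 h; rewrite -(real_normK (num_real b)).
apply: le_lt_trans h; rewrite expr2 ler_wpM2l //; exact: ltW (schur_normb S).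
Qed.

Lemma char_min_modulusE : schur b c ->
  char_min_modulus b c =
  if (0 < c) && (`|b| * (1 + c) < 4 * c)
  then (1 - c) * Num.sqrt (1 - b ^+ 2 / (4 * c)) else 1 + c - `|b|.
Proof.
move=> S; have [c_gtN1 c_lt1 b_gtN b_lt1] := S.
have nb_lt := schur_normb S.
rewrite /char_min_modulus; have [c0|c0] /= := boolP (0 < c).
  rewrite interior_vertexE //; case: ifP => _.
    by rewrite ger0_norm //; lra.
  have -> : `|1 + c| = 1 + c by rewrite ger0_norm //; lra.
  by rewrite ger0_norm // subr_ge0 ltW.
have -> : `|1 + c| = 1 + c by rewrite ger0_norm //; lra.
by rewrite ger0_norm // subr_ge0 ltW.
Qed.

Lemma char_min_modulus_gt0 : schur b c ->
  0 < char_min_modulus b c.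
Proof.
move=> S; have [c_gtN1 c_lt1 b_gtN b_lt1] := S.
have nb_lt := schur_normb S.
rewrite (char_min_modulusE S); case: ifP => [/andP[c0 h]|_]; last first.
  by rewrite subr_gt0 schur_normb.
apply: mulr_gt0; first by lra.
rewrite sqrtr_gt0 subr_gt0 ltr_pdivrMr ?mul1r; last by lra.
exact: discriminant_lt0 S c0 h.
Qed.

Lemma char_min_modulus_sqr : schur b c ->
  char_min_modulus b c ^+ 2 =
  if (0 < c) && (`|b| * (1 + c) < 4 * c)
  then (1 - c) ^+ 2 * (1 - b ^+ 2 / (4 * c)) else (1 + c - `|b|) ^+ 2.
Proof.
move=> S; have [c_gtN1 c_lt1 b_gtN b_lt1] := S.
have nb_lt := schur_normb S.
rewrite (char_min_modulusE S); case: ifP => [/andP[c0 h]|_] //.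
rewrite exprMn sqr_sqrtr // subr_ge0 ler_pdivrMr ?mul1r; last by lra.
exact/ltW/(discriminant_lt0 S c0 h).
Qed.

(** Completing the square in t: the first summand is the value at the vertex
    t = - b (1 + c) / (4 c). *)
Lemma char_modulus2_vertex (t : R) : 0 < c ->
  char_modulus2 b c t = (1 - c) ^+ 2 * (1 - b ^+ 2 / (4 * c)) +
    4 * c * (t + b * (1 + c) / (4 * c)) ^+ 2.
Proof. by move=> c0; rewrite /char_modulus2; field; lra. Qed.

(** When the vertex is not interior, or when the quadratic is concave in t, the
    minimum is at the endpoint t = - sg b; subtracting its value leaves a product
    of two nonnegative factors. *)
Lemma char_min_modulus_le (t : R) : schur b c ->
  -1 <= t <= 1 ->
  char_min_modulus b c ^+ 2 <= char_modulus2 b c t.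
Proof.
move=> S; have [c_gtN1 c_lt1 b_gtN b_lt1] := S.
have nb_lt := schur_normb S.
move=> /andP[t1 t2]; rewrite (char_min_modulus_sqr S); case: ifP => [/andP[c0 _]|/negbT].
  by rewrite char_modulus2_vertex // lerDl mulr_ge0 ?sqr_ge0 //; lra.
rewrite negb_and -!leNgt => h.
have [b0|b0] := leP 0 b.
  rewrite ger0_norm // in h *.
  have -> : char_modulus2 b c t = (1 + c - b) ^+ 2 +
    (1 + t) * (2 * b * (1 + c) - 4 * c * (1 - t)).
    by rewrite /char_modulus2; ring.
  rewrite lerDl mulr_ge0 //; first by lra.
  have [c0|c0] := leP c 0; last first.
    have {}h : 4 * c <= b * (1 + c) by case/orP: h => h; lra.
    have : 0 <= c * (1 + t) by apply: mulr_ge0; lra.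
    by lra.
  clear h.
  have : 0 <= b * (1 + c) by apply: mulr_ge0; lra.
  have : 0 <= - c * (1 - t) by apply: mulr_ge0; lra.
  lra.
rewrite ltr0_norm // in h *.
have -> : char_modulus2 b c t = (1 + c - - b) ^+ 2 +
  (1 - t) * (- 2 * b * (1 + c) - 4 * c * (1 + t)).
  by rewrite /char_modulus2; ring.
rewrite lerDl mulr_ge0 //; first by lra.
have [c0|c0] := leP c 0; last first.
  have {}h : 4 * c <= - b * (1 + c) by case/orP: h => h; lra.
  have : 0 <= c * (1 - t) by apply: mulr_ge0; lra.
  by lra.
clear h.
have : 0 <= - b * (1 + c) by apply: mulr_ge0; lra.
have : 0 <= - c * (1 + t) by apply: mulr_ge0; lra.
lra.
Qed.

Lemma char_min_modulus_attained : schur b c ->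
  exists2 t : R, (-1 <= t <= 1) & char_modulus2 b c t = char_min_modulus b c ^+ 2.
Proof.
move=> S; have [c_gtN1 c_lt1 b_gtN b_lt1] := S.
have nb_lt := schur_normb S.
rewrite (char_min_modulus_sqr S); case: ifP => [/andP[c0 h]|_].
  exists (- (b * (1 + c) / (4 * c))); last first.
    by rewrite char_modulus2_vertex // addNr expr0n /= mulr0 addr0.
  rewrite -ler_norml normrN normrM normfV normrM !(@ger0_norm _ (1 + c))
    ?(@ger0_norm _ (4 * c)) ?ler_pdivrMr ?mul1r; lra.
have [b0|b0] := leP 0 b.
  by exists (-1); [rewrite lexx; lra | rewrite /char_modulus2 ger0_norm //; ring].
by exists 1; [rewrite lexx andbT; lra | rewrite /char_modulus2 ltr0_norm //; ring].
Qed.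

Lemma char_min_modulus_le1 : schur b c ->
  char_min_modulus b c <= 1 + b + c.
Proof.
move=> S; have [c_gtN1 c_lt1 b_gtN b_lt1] := S.
have nb_lt := schur_normb S.
rewrite -(@ler_pXn2r _ 2) ?nnegrE //; last by lra.
  have -> : (1 + b + c) ^+ 2 = char_modulus2 b c 1.
    by rewrite /char_modulus2; ring.
  by apply: (char_min_modulus_le S); rewrite lexx ?andbT; lra.
exact/ltW/(char_min_modulus_gt0 S).
Qed.

Lemma char_min_modulus_leN1 : schur b c ->
  char_min_modulus b c <= 1 + c - b.
Proof.
move=> S; have [c_gtN1 c_lt1 b_gtN b_lt1] := S.
have nb_lt := schur_normb S.
rewrite -(@ler_pXn2r _ 2) ?nnegrE //; last by lra.
  have -> : (1 + c - b) ^+ 2 = char_modulus2 b c (-1).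
    by rewrite /char_modulus2; ring.
  by apply: (char_min_modulus_le S); rewrite lexx ?andbT; lra.
exact/ltW/(char_min_modulus_gt0 S).
Qed.

(** The case in which the worst frequency is z = 1: an interior vertex lies
    strictly below both endpoints, and for b > 0 the endpoint t = -1 is lower. *)
Lemma char_min_modulus_eq1 : schur b c ->
  (char_min_modulus b c = 1 + b + c <->
  b <= 0 /\ ~~ ((0 < c) && (`|b| * (1 + c) < 4 * c))).
Proof.
move=> S; have [c_gtN1 c_lt1 b_gtN b_lt1] := S.
have nb_lt := schur_normb S.
split=> [h|[b0 /negbTE h]]; last first.
  by rewrite (char_min_modulusE S) h ler0_norm //; ring.
have [b0|b0] := lerP b 0; last by have := char_min_modulus_leN1 S; lra.
split=> //; apply/negP => /andP[c0 h1].
have : char_modulus2 b c 1 = char_min_modulus b c ^+ 2.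
  by rewrite h /char_modulus2; ring.
rewrite (char_min_modulus_sqr S) c0 h1 /= char_modulus2_vertex //.
rewrite -[RHS]addr0 => /addrI /eqP; rewrite mulf_eq0 sqrf_eq0 => /orP[/eqP|/eqP e].
  by lra.
have : b * (1 + c) = - (4 * c).
  have -> : b * (1 + c) = (b * (1 + c) / (4 * c)) * (4 * c) by field; lra.
  have -> : b * (1 + c) / (4 * c) = -1 by lra.
  by ring.
rewrite ler0_norm // in h1; lra.
Qed.

(** A spectral factor a0 z^2 + a1 z + a2 with
    |chi|^2 - r^2 = |a0 z^2 + a1 z + a2|^2 on the circle yields the storage
    function with matrix entries 1 - a0^2, b - a0 a1, a2^2 - c^2. The slack in the
    dissipation inequality is the square of a0 y + a1 u + a2 v. *)
Lemma storage_function : schur b c ->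
  exists A B C : R,
  [/\ forall u v, 0 <= A * u ^+ 2 + 2 * B * u * v + C * v ^+ 2 &
      forall y u v, char_min_modulus b c ^+ 2 * u ^+ 2 +
         (A * y ^+ 2 + 2 * B * y * u + C * u ^+ 2) <=
         (y + b * u + c * v) ^+ 2 +
         (A * u ^+ 2 + 2 * B * u * v + C * v ^+ 2)].
Proof.
move=> S; have [c_gtN1 c_lt1 b_gtN b_lt1] := S.
have nb_lt := schur_normb S.
(* The first three equations match the autocorrelation coefficients of the two
   polynomials; the last two make the storage function nonnegative. *)
suff [a0 [a1 [a2 [e0 e1 e2 a0le P]]]] : exists a0 a1 a2 : R,
  [/\ a0 * a2 = c, a1 * (a0 + a2) = b * (1 + c),
      a0 ^+ 2 + a1 ^+ 2 + a2 ^+ 2 + char_min_modulus b c ^+ 2 = 1 + b ^+ 2 + c ^+ 2,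
      a0 ^+ 2 <= 1 &
      (b - a0 * a1) ^+ 2 <= (1 - a0 ^+ 2) * (a2 ^+ 2 - c ^+ 2)].
  exists (1 - a0 ^+ 2), (b - a0 * a1), (a2 ^+ 2 - c ^+ 2); split=> [u v|y u v].
    move: P; set A := 1 - _; set B := b - _; set C := a2 ^+ 2 - _ => P.
    have A0 : 0 <= A by rewrite /A; lra.
    have C0 : 0 <= C.
      by rewrite /C -e0; have := sqr_ge0 a2; nra.
    have [A1|A1] := eqVneq A 0.
      have B0 : B = 0 by apply/eqP; rewrite -sqrf_eq0 eq_le sqr_ge0; nra.
      by rewrite A1 B0; have := sqr_ge0 v; nra.
    have A2 : 0 < A by rewrite lt_neqAle eq_sym A1.
    rewrite -(pmulr_rge0 _ A2).
    have -> : A * (A * u ^+ 2 + 2 * B * u * v + C * v ^+ 2) =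
      (A * u + B * v) ^+ 2 + (A * C - B ^+ 2) * v ^+ 2 by ring.
    by rewrite addr_ge0 ?sqr_ge0 // mulr_ge0 ?sqr_ge0 // subr_ge0.
  rewrite -subr_ge0.
  suff -> : (y + b * u + c * v) ^+ 2 +
     ((1 - a0 ^+ 2) * u ^+ 2 + 2 * (b - a0 * a1) * u * v + (a2 ^+ 2 - c ^+ 2) * v ^+ 2) -
    (char_min_modulus b c ^+ 2 * u ^+ 2 +
      ((1 - a0 ^+ 2) * y ^+ 2 + 2 * (b - a0 * a1) * y * u + (a2 ^+ 2 - c ^+ 2) * u ^+ 2))
    = (a0 * y + a1 * u + a2 * v) ^+ 2 by exact: sqr_ge0.
  have -> : char_min_modulus b c ^+ 2 = 1 + b ^+ 2 + c ^+ 2 - (a0 ^+ 2 + a1 ^+ 2 + a2 ^+ 2).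
    by rewrite -e2; ring.
  apply/eqP; rewrite -subr_eq0; apply/eqP.
  transitivity (2 * y * v * (c - a0 * a2) + 2 * u * v * (b * (1 + c) - a1 * (a0 + a2))).
    by ring.
  by rewrite e0 e1; ring.
rewrite (char_min_modulus_sqr S); case: ifP => [/andP[c0 h]|/negbT].
  have s0 : 0 < Num.sqrt c by rewrite sqrtr_gt0.
  have s2 : Num.sqrt c ^+ 2 = c by rewrite sqr_sqrtr // ltW.
  (* Interior vertex: the factor has a conjugate pair of roots on the circle. *)
  exists (Num.sqrt c), (b * (1 + c) / (2 * Num.sqrt c)), (Num.sqrt c).
  move: s0 s2; set s := Num.sqrt c => s0 s2; rewrite -!s2.
  have d0 := discriminant_lt0 S c0 h.
  have sn0 : s != 0 by lra.
  split; [by ring | by field| by field | by lra |].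
  have -> : b - s * (b * (1 + s ^+ 2) / (2 * s)) = b * (1 - s ^+ 2) / 2 by field.
  rewrite s2; have -> : (1 - c) * (c - c ^+ 2) = (1 - c) ^+ 2 * c by ring.
  have -> : (b * (1 - c) / 2) ^+ 2 = (1 - c) ^+ 2 * (b ^+ 2 / 4) by field.
  by apply: ler_wpM2l; [exact: sqr_ge0 | lra].
rewrite negb_and -!leNgt => h.
(* Minimum at t = -1 or t = 1: that point is a root of the factor, so that
   |a1| = |a0 + a2|, and then (a0 + a2)^2 = |b| (1 + c). *)
have nb0 := normr_ge0 b.
pose sg : R := if b < 0 then -1 else 1.
have sgb : sg * `|b| = b.
  rewrite /sg; case: ltP => b0; last by rewrite ger0_norm // mul1r.
  by rewrite ltr0_norm //; ring.
have sg2 : sg ^+ 2 = 1 by rewrite /sg; case: ifP => _; ring.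
move: h nb0 sgb (schur_normb S); rewrite -(real_normK (num_real b)).
move: (`|b|) => m h nb0 <- mlt.
set s := Num.sqrt (m * (1 + c)).
have s0 : 0 <= s by exact: sqrtr_ge0.
have s2 : s ^+ 2 = m * (1 + c) by rewrite sqr_sqrtr //; nra.
have d0 : 0 <= s ^+ 2 - 4 * c by rewrite s2; case/orP: h => h; nra.
have e2 := sqr_sqrtr d0.
have e0 := sqrtr_ge0 (s ^+ 2 - 4 * c).
move: e2 e0; set e := Num.sqrt (s ^+ 2 - 4 * c) => e2 e0.
have slt : s < 1 + c by rewrite -(@ltr_pXn2r _ 2) ?nnegrE //; nra.
exists ((s - e) / 2), (sg * s), ((s + e) / 2).
have ce : c = (s ^+ 2 - e ^+ 2) / 4 by lra.
have p1 : (s - e) / 2 * ((s + e) / 2) = c by rewrite ce; field.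
have p2 : (s - e) / 2 + (s + e) / 2 = s by field.
move: p1 p2; set a0 := (s - e) / 2; set a2 := (s + e) / 2 => p1 p2.
have a0b : -1 <= a0 /\ a0 <= 1 by rewrite /a0; split; nra.
split=> //.
- by rewrite p2 -mulrA -expr2 s2; ring.
- have -> : a0 ^+ 2 + (sg * s) ^+ 2 + a2 ^+ 2 =
      (a0 + a2) ^+ 2 - 2 * (a0 * a2) + sg ^+ 2 * s ^+ 2 by ring.
  by rewrite p2 p1 sg2 s2; ring.
- by nra.
have -> : sg * m - a0 * (sg * s) = sg * (m - a0 * s) by ring.
rewrite exprMn sg2 mul1r.
have -> : (1 - a0 ^+ 2) * (a2 ^+ 2 - c ^+ 2) = (a2 * (1 - a0 ^+ 2)) ^+ 2 by rewrite -p1; ring.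
have c1 : 0 < 1 + c by lra.
have -> : m - a0 * s = a2 * (1 - a0 ^+ 2) * (s / (1 + c)).
  have -> : m = s ^+ 2 / (1 + c) by rewrite s2; field; lra.
  move: c1; rewrite -p1 -p2 => c1; field; lra.
rewrite [leLHS]exprMn ler_piMr ?sqr_ge0 // expr_le1 // ?divr_ge0 ?ler_pdivrMr //; lra.
Qed.

End MinModulus.

(** * Monotone and quasi-concave curves between modes *)

Section ExtremeModes.
Variables (R : realFieldType) (be nu : R).

(** The coefficients [b_lam] and [c_lam] as functions of x = alpha lam. *)
Definition mode_b (x : R) : R := x * (1 + nu) - (1 + be).
Definition mode_c (x : R) : R := be - x * nu.
(** The inverse squared gain of a mode, up to a constant factor, at the point of
    the unit circle with real part 1 - s. *)
Definition scaled_modulus2 (x s : R) : R :=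
  char_modulus2 (mode_b x) (mode_c x) (1 - s) / x.
Local Notation F := scaled_modulus2.

(** A concave function on [l, u] has its minimum at an endpoint; for a quadratic
    the sign of the slope of one chord decides which. *)
Lemma quadratic_min_endpoint (a0 a1 a2 l x u : R) : a2 <= 0 -> l <= x -> x <= u ->
  a0 + a1 * l + a2 * l ^+ 2 <= a0 + a1 * x + a2 * x ^+ 2 \/
  a0 + a1 * u + a2 * u ^+ 2 <= a0 + a1 * x + a2 * x ^+ 2.
Proof.
move=> a2le lx xu; have [h|h] := leP 0 (a1 + a2 * (x + l)).
  by left; have := mulr_ge0 (_ : 0 <= x - l) h; rewrite subr_ge0 => /(_ lx); lra.
right; have h2 : 0 <= - (a1 + a2 * (x + u)).
  by have : a2 * u <= a2 * l; [apply: ler_wnM2l => //; lra | lra].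
by have := mulr_ge0 (_ : 0 <= u - x) h2; rewrite subr_ge0 => /(_ xu); lra.
Qed.

Lemma scaled_modulus2_proportional (k w : R) : w != 0 ->
  F w (k * w) = 2 * k * (1 - be) ^+ 2 +
   ((1 - 2 * k) ^+ 2 + 2 * k * (1 - be) * (1 + 2 * nu - 2 * k)) * w +
   (2 * k * nu * (nu + 1 - 2 * k)) * w ^+ 2.
Proof.
by move=> w0; rewrite /F /char_modulus2 /mode_b /mode_c; field.
Qed.

(** For c close to 1 the polynomial has a near-root on the circle, close to
    s = x / 2. Curves that deviate from it by a multiple of 1 - c keep the
    factor (1 - c)^2. *)
Lemma scaled_modulus2_resonant (eta w : R) : w != 0 ->
  let D := 1 - mode_c w in
  F w ((w + eta * D) / 2) = D ^+ 2 / w *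
   (eta ^+ 2 + (1 - eta) * eta * (1 - be) + (1 - eta) * (1 + eta * nu) * w).
Proof.
by move=> w0 /=; rewrite /F /char_modulus2 /mode_b /mode_c; field.
Qed.

Lemma scaled_modulus2_ge0 (w s : R) : 0 < w -> 0 <= s -> s <= 2 -> 0 <= F w s.
Proof.
move=> w0 s0 s2; rewrite divr_ge0 ?(ltW w0) // /char_modulus2.
move: (mode_b w) (mode_c w) => b c.
have -> : 4 * c * (1 - s) ^+ 2 + 2 * b * (1 + c) * (1 - s) + b ^+ 2 + (1 - c) ^+ 2 =
  ((1 + c) * (1 - s) + b) ^+ 2 + (1 - c) ^+ 2 * (s * (2 - s)) by ring.
rewrite addr_ge0 ?sqr_ge0 // mulr_ge0 ?sqr_ge0 // mulr_ge0 //; lra.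
Qed.

(** At z = -1 the modulus is 1 + c - b, which decreases in x. This continues a
    curve to the right once it has reached s = 2. *)
Lemma scaled_modulus2_antipodal_decr (w u : R) : 0 <= nu -> 0 < w -> w <= u ->
  0 <= 1 + mode_c u - mode_b u -> F u 2 <= F w 2.
Proof.
move=> nu0 w0 wu; set y := (Y in 0 <= Y) => y0; rewrite /F.
have -> : char_modulus2 (mode_b u) (mode_c u) (1 - 2) = y ^+ 2.
  by rewrite /char_modulus2 /y; ring.
have -> : char_modulus2 (mode_b w) (mode_c w) (1 - 2) =
    (1 + mode_c w - mode_b w) ^+ 2 by rewrite /char_modulus2; ring.
have h : y <= 1 + mode_c w - mode_b w.
  rewrite /y /mode_c /mode_b; have : w * nu <= u * nu by apply: ler_wpM2r.
  lra.
apply: ler_pM; rewrite ?sqr_ge0 ?invr_ge0 //; first by lra.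
  by rewrite ler_pXn2r // nnegrE // (le_trans y0).
by rewrite lef_pV2 // posrE; lra.
Qed.

(** Convexity of the inverse on positive numbers, with denominators cleared on the
    chord. *)
Lemma inv_chord (p r q : R) : 0 < p -> p <= r -> r <= q ->
  (q - p) / r <= (q - r) / p + (r - p) / q.
Proof.
move=> p0 pr rq; rewrite -subr_ge0.
have -> : (q - r) / p + (r - p) / q - (q - p) / r =
  (q - r) * (r - p) * (q - p) / (p * q * r) by field; lra.
by rewrite divr_ge0 // !mulr_ge0 //; lra.
Qed.

Lemma inv_sqr_chord (p r q : R) : 0 < p -> p <= r -> r <= q ->
  (q - p) / r ^+ 2 <= (q - r) / p ^+ 2 + (r - p) / q ^+ 2.
Proof.
move=> p0 pr rq; rewrite -subr_ge0.
have -> : (q - r) / p ^+ 2 + (r - p) / q ^+ 2 - (q - p) / r ^+ 2 =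
  (q - r) * (r - p) * (q - p) * (p * q + q * r + p * r) / (p * q * r) ^+ 2.
  by field; lra.
have pq : 0 <= p * q by apply: mulr_ge0; lra.
have qr : 0 <= q * r by apply: mulr_ge0; lra.
have pr0 : 0 <= p * r by apply: mulr_ge0; lra.
rewrite divr_ge0 ?sqr_ge0 // mulr_ge0 //; last by lra.
by rewrite !mulr_ge0 //; lra.
Qed.

Hypothesis (nu_ge0 : 0 <= nu).

(** After division by x - l the increment is a square plus a multiple of k; for
    be > 1 the negative term is absorbed with be - 1 <= nu * l, which is the
    hypothesis c < 1 at the left end. *)
Lemma proportional_path_incr (k l x : R) : 0 < l -> l <= x -> 0 <= k ->
  2 * k <= 1 + nu -> mode_c l < 1 -> (be <= 1 \/ 2 * k <= 1) ->
  F l (k * l) <= F x (k * x).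
Proof.
move: nu_ge0 => nu0 l0 lx k0 knu cl h.
rewrite !scaled_modulus2_proportional; [|lra|lra].
rewrite -subr_ge0; set X := (X in 0 <= X).
have -> : X = (x - l) * ((1 - 2 * k) ^+ 2 + 2 * k * ((1 - be) * (1 + 2 * nu - 2 * k) +
     nu * (nu + 1 - 2 * k) * (x + l))) by rewrite /X; ring.
apply: mulr_ge0; first by lra.
have [be1|be1] := leP be 1.
  rewrite addr_ge0 ?sqr_ge0 // mulr_ge0 ?mulr_ge0 // addr_ge0 ?mulr_ge0 //; lra.
have k1 : 2 * k <= 1 by case: h; lra.
rewrite addr_ge0 ?sqr_ge0 // mulr_ge0 ?mulr_ge0 //.
have h1 : be - 1 <= nu * l by move: cl; rewrite /mode_c; lra.
have h2 : 2 * (be - 1) <= nu * (x + l).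
  by have : nu * l <= nu * x; [exact: ler_wpM2l | lra].
have : 2 * (be - 1) * (nu + 1 - 2 * k) <= nu * (x + l) * (nu + 1 - 2 * k).
  by apply: ler_wpM2r => //; lra.
have : 0 <= (be - 1) * (1 - 2 * k) by apply: mulr_ge0; lra.
lra.
Qed.

Lemma proportional_path_concave (k l x u : R) : 0 < l -> l <= x -> x <= u ->
  1 + nu <= 2 * k -> F l (k * l) <= F x (k * x) \/ F u (k * u) <= F x (k * x).
Proof.
move: nu_ge0 => nu0 l0 lx xu k1.
rewrite !scaled_modulus2_proportional; [|lra|lra|lra].
apply: quadratic_min_endpoint => //.
have : 0 <= 2 * k * nu * (2 * k - nu - 1) by rewrite !mulr_ge0 //; lra.
by lra.
Qed.

Lemma mode_D_incr (l x : R) : l <= x -> 1 - mode_c l <= 1 - mode_c x.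
Proof.
move: nu_ge0 => nu0 lx; have : l * nu <= x * nu by exact: ler_wpM2r.
rewrite /mode_c; lra.
Qed.

(** For be >= 1 both 1 - c(w) and (1 - c(w)) / w are nondecreasing, and the
    function is a combination of their products with nonnegative coefficients. *)
Lemma resonant_path_incr (eta l x : R) : 0 < l -> l <= x -> mode_c l < 1 ->
  1 <= be -> 0 <= eta -> eta <= 1 ->
  F l ((l + eta * (1 - mode_c l)) / 2) <= F x ((x + eta * (1 - mode_c x)) / 2).
Proof.
move: nu_ge0 => nu0 l0 lx cl be1 e0 e1.
have D1 := mode_D_incr lx.
have Dl : 0 < 1 - mode_c l by lra.
have E1 : (1 - mode_c l) / l <= (1 - mode_c x) / x.
  have EE w : 0 < w -> (1 - mode_c w) / w = nu - (be - 1) / w.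
    by move=> w0; rewrite /mode_c; field; lra.
  rewrite !EE; [|lra|lra].
  by rewrite lerD2l lerN2 ler_wpM2l ?lef_pV2 ?posrE //; lra.
have EE w : 0 < w -> F w ((w + eta * (1 - mode_c w)) / 2) =
  eta ^+ 2 * ((1 - mode_c w) * ((1 - mode_c w) / w)) + (1 - eta) * (1 - mode_c w) ^+ 2
  + (1 - eta) * eta * ((1 - mode_c w) ^+ 2 * ((1 - mode_c w) / w)).
  by move=> w0; rewrite scaled_modulus2_resonant ?gt_eqF // /mode_c; field; lra.
rewrite !EE; [|lra|lra].
have E0 : 0 <= (1 - mode_c l) / l by rewrite divr_ge0; lra.
have D2 : (1 - mode_c l) ^+ 2 <= (1 - mode_c x) ^+ 2.
  by rewrite ler_pXn2r // nnegrE; lra.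
have Dl2 := sqr_ge0 (1 - mode_c l).
apply: lerD; [apply: lerD|].
- by apply: ler_wpM2l; [exact: sqr_ge0 | apply: ler_pM => //; lra].
- by apply: ler_wpM2l => //; lra.
- by apply: ler_wpM2l; [apply: mulr_ge0; lra | apply: ler_pM].
Qed.

(** Along the curve the function is D^2 / w * (A + B w) with D = 1 - c(w). It is at
    least m exactly when A + B w - m w / D^2 >= 0, and that expression is concave in
    w: because w is affine in D, w / D^2 is a nonnegative combination of 1 / D and
    1 / D^2. *)
Lemma resonant_path_quasiconcave (eta l x u : R) : 0 < l -> l <= x -> x <= u ->
  mode_c l < 1 -> 1 <= be -> 1 <= eta ->
  let G w := F w ((w + eta * (1 - mode_c w)) / 2) in
  0 <= G x -> G l <= G x \/ G u <= G x.
Proof.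
move: nu_ge0 => nu0 l0 lx xu cl be1 e1 G G0.
have [lex|ltx] := boolP ((G l <= G x) || (G u <= G x)); first by case/orP: lex; auto.
exfalso; move: ltx; rewrite negb_or -!ltNge => /andP[Gl Gu].
have D1 := mode_D_incr lx; have D2 := mode_D_incr xu.
have nu1 : 0 < nu.
  rewrite lt_neqAle nu0 andbT eq_sym; apply/eqP => n0.
  by move: cl; rewrite /mode_c n0; lra.
set A := eta ^+ 2 + (1 - eta) * eta * (1 - be).
set B := (1 - eta) * (1 + eta * nu).
have GE w : 0 < w -> G w = (1 - mode_c w) ^+ 2 / w * (A + B * w).
  by move=> w0; rewrite /G scaled_modulus2_resonant // gt_eqF.
set m := G x in G0 Gl Gu.
pose f w := nu^-1 * (1 / (1 - mode_c w) + (be - 1) / (1 - mode_c w) ^+ 2).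
have fE w : 0 < w -> 0 < 1 - mode_c w -> f w = w / (1 - mode_c w) ^+ 2.
  move=> w0 Dw; rewrite /f; have -> : be - 1 = nu * w - (1 - mode_c w).
    by rewrite /mode_c; ring.
  by field; lra.
have GA w : 0 < w -> 0 < 1 - mode_c w ->
    A + B * w - m * f w = (G w - m) * (w / (1 - mode_c w) ^+ 2).
  by move=> w0 Dw; rewrite fE // GE //; field; lra.
have pos w : 0 < w -> 0 < 1 - mode_c w -> 0 < w / (1 - mode_c w) ^+ 2.
  by move=> w0 Dw; rewrite divr_gt0 // exprn_gt0.
have Ml : 0 < A + B * l - m * f l.
  by rewrite GA; [|lra|lra]; apply: mulr_gt0; [lra | apply: pos; lra].
have Mu : 0 < A + B * u - m * f u.
  by rewrite GA; [|lra|lra]; apply: mulr_gt0; [lra | apply: pos; lra].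
have Mx : A + B * x - m * f x = 0.
  by rewrite GA; [|lra|lra]; rewrite subrr mul0r.
have fconv : (u - l) * f x <= (u - x) * f l + (x - l) * f u.
  set p := 1 - mode_c l; set r := 1 - mode_c x; set q := 1 - mode_c u.
  have hp : 0 < p by rewrite /p; lra.
  have hpr : p <= r by rewrite /p /r; lra.
  have hrq : r <= q by rewrite /r /q; lra.
  have c1 := inv_chord hp hpr hrq.
  have c2 := inv_sqr_chord hp hpr hrq.
  have e1' : u - l = (q - p) / nu by rewrite /q /p /mode_c; field; lra.
  have e2' : u - x = (q - r) / nu by rewrite /q /r /mode_c; field; lra.
  have e3' : x - l = (r - p) / nu by rewrite /r /p /mode_c; field; lra.
  rewrite e1' e2' e3' /f -/p -/q -/r -subr_ge0.
  have -> : (q - r) / nu * (nu^-1 * (1 / p + (be - 1) / p ^+ 2)) +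
     (r - p) / nu * (nu^-1 * (1 / q + (be - 1) / q ^+ 2)) -
     (q - p) / nu * (nu^-1 * (1 / r + (be - 1) / r ^+ 2)) =
     (nu^-1) ^+ 2 * (((q - r) / p + (r - p) / q - (q - p) / r) +
       (be - 1) * ((q - r) / p ^+ 2 + (r - p) / q ^+ 2 - (q - p) / r ^+ 2)).
    by field; lra.
  by rewrite mulr_ge0 ?sqr_ge0 // addr_ge0 ?mulr_ge0 ?subr_ge0.
have h1 : 0 <= m * ((u - x) * f l + (x - l) * f u - (u - l) * f x).
  by rewrite mulr_ge0 ?subr_ge0.
have ul : l < u.
  rewrite lt_neqAle (le_trans lx xu) andbT; apply/eqP => lu.
  have xl : x = l by lra.
  by move: Gl; rewrite /m xl ltxx.
have [xl|xl] := eqVneq x l; first by move: Gl; rewrite /m xl ltxx.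
have xl' : 0 < x - l by rewrite subr_gt0 lt_neqAle eq_sym xl.
have h2 : 0 < (x - l) * (A + B * u - m * f u) by apply: mulr_gt0.
have h3 : 0 <= (u - x) * (A + B * l - m * f l) by apply: mulr_ge0; [lra|exact: ltW].
have h4 : (u - l) * (A + B * x - m * f x) = 0 by rewrite Mx mulr0.
have h5 : (u - l) * (A + B * x - m * f x) =
  (u - x) * (A + B * l - m * f l) + (x - l) * (A + B * u - m * f u) +
  m * ((u - x) * f l + (x - l) * f u - (u - l) * f x).
  by ring.
move: h1 h2 h3 h4 h5.
move: ((u - l) * _) ((x - l) * _) (m * _) => v1 v2 v3.
by move: ((u - x) * _) => v4; lra.
Qed.

(** The curve through (x, s) is chosen by cases. The proportional curve s = k w is
    concave for 2 k >= 1 + nu, and nondecreasing below that bound if be <= 1 or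
    s <= x / 2. In the remaining case be > 1 and s > x / 2, so s is on a resonant
    curve with eta >= 0, nondecreasing for eta <= 1 and quasi-concave for
    eta >= 1. All these curves have s increasing in w, so they can leave [0, 2] only
    on the right, through s = 2. *)
Lemma scaled_modulus2_min_endpoint (l x u s : R) :
  0 < l -> l <= x -> x <= u -> mode_c l < 1 -> 0 <= 1 + mode_c u - mode_b u ->
  0 <= s -> s <= 2 ->
  exists2 s', 0 <= s' <= 2 & F l s' <= F x s \/ F u s' <= F x s.
Proof.
move: nu_ge0 => nu0 l0 lx xu cl yu s0 s2.
have x0 : 0 < x by lra.
have Fx0 := scaled_modulus2_ge0 x0 s0 s2.
have yw w : w <= u -> 0 <= 1 + mode_c w - mode_b w.
  move=> wu; have : w * nu <= u * nu by exact: ler_wpM2r.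
  by move: yu; rewrite /mode_c /mode_b; lra.
have Dx := mode_D_incr lx.
pose k := s / x.
have sE : s = k * x by rewrite /k; field; lra.
have k0 : 0 <= k by rewrite divr_ge0 // ltW.
have klx : k * l <= k * x by apply: ler_wpM2l.
have kl0 : 0 <= k * l by apply: mulr_ge0 => //; lra.
have [knu|knu] := leP (1 + nu) (2 * k).
  have [ku|ku] := leP (k * u) 2.
    have ku0 : 0 <= k * u by apply: mulr_ge0 => //; lra.
    rewrite sE; case: (proportional_path_concave l0 lx xu knu) => h.
      by exists (k * l); [apply/andP; split; lra | left].
    by exists (k * u); [apply/andP; split; lra | right].
  (* The curve reaches s = 2 at w = 2 / k, before u. *)
  have k1 : 0 < k by lra.
  have xw : x <= 2 / k by rewrite ler_pdivlMr //; lra.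
  have wu : 2 / k <= u by rewrite ler_pdivrMr //; lra.
  rewrite sE; case: (proportional_path_concave l0 lx xw knu) => h.
    by exists (k * l); [apply/andP; split; lra | left].
  exists 2; [by apply/andP; split; lra | right].
  have w0 : 0 < 2 / k by rewrite divr_gt0.
  apply: le_trans (scaled_modulus2_antipodal_decr nu0 w0 wu yu) _.
  by have -> : F (2 / k) 2 = F (2 / k) (k * (2 / k)); [congr F; field; lra | ].
have knu' := ltW knu.
have [/orP hk|] := boolP ((be <= 1) || (2 * k <= 1)).
  exists (k * l); [by apply/andP; split; lra | left].
  by rewrite sE; apply: proportional_path_incr.
rewrite negb_or -!ltNge => /andP[be1 k1].
have Dx0 : 0 < 1 - mode_c x by lra.
have Dl0 : 0 < 1 - mode_c l by lra.
pose eta := (2 * s - x) / (1 - mode_c x).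
have sE' : s = (x + eta * (1 - mode_c x)) / 2.
  by rewrite /eta; field; move: Dx0; rewrite /mode_c; lra.
have e0 : 0 <= eta.
  rewrite divr_ge0 ?(ltW Dx0) // sE.
  have -> : 2 * (k * x) - x = (2 * k - 1) * x by ring.
  by apply: mulr_ge0; lra.
have eD w : l <= w -> 0 <= eta * (1 - mode_c w).
  by move=> lw; apply: mulr_ge0 => //; have := mode_D_incr lw; lra.
have eDm w v : w <= v -> eta * (1 - mode_c w) <= eta * (1 - mode_c v).
  by move=> wv; apply: ler_wpM2l => //; exact: mode_D_incr.
have sl : 0 <= (l + eta * (1 - mode_c l)) / 2 <= 2.
  by apply/andP; split; [have := eD l (lexx _); lra | have := eDm l x lx; lra].
have [e1|e1] := leP eta 1.
  exists ((l + eta * (1 - mode_c l)) / 2) => //; left.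
  by rewrite sE'; apply: resonant_path_incr => //; lra.
have [su|su] := leP ((u + eta * (1 - mode_c u)) / 2) 2.
  have := @resonant_path_quasiconcave eta l x u l0 lx xu cl (ltW be1) (ltW e1).
  rewrite /= -sE' => /(_ Fx0) [h|h].
    by exists ((l + eta * (1 - mode_c l)) / 2) => //; left.
  exists ((u + eta * (1 - mode_c u)) / 2); last by right.
  by rewrite su andbT; have := eD u (le_trans lx xu); lra.
(* The curve reaches s = 2 at the abscissa w below, before u. *)
have en : 0 <= eta * nu by apply: mulr_ge0.
pose w := (4 - eta * (1 - be)) / (1 + eta * nu).
have wE v : v + eta * (1 - mode_c v) = 4 + (v - w) * (1 + eta * nu).
  by rewrite /w /mode_c; field; lra.
have xw : x <= w.
  rewrite -subr_le0 -(@pmulr_lle0 _ (1 + eta * nu)); last by lra.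
  by have := wE x; lra.
have wu : w <= u.
  rewrite -subr_ge0 -(@pmulr_lge0 _ (1 + eta * nu)); last by lra.
  by have := wE u; lra.
have := @resonant_path_quasiconcave eta l x w l0 lx xw cl (ltW be1) (ltW e1).
rewrite /= -sE' => /(_ Fx0) [h|h].
  by exists ((l + eta * (1 - mode_c l)) / 2) => //; left.
exists 2; [by apply/andP; split; lra | right].
have w0 : 0 < w by lra.
apply: le_trans (scaled_modulus2_antipodal_decr nu0 w0 wu yu) _.
apply: le_trans h; rewrite wE subrr mul0r addr0.
by have -> : 4 / 2 = 2 :> R by field.
Qed.

End ExtremeModes.

(** * Complex moduli, Euclidean norms and root location *)

Section ComplexModulus.
Variable R : rcfType.

Lemma sqr_normcE (z : R[i]) : normc z ^+ 2 = complex.Re z ^+ 2 + complex.Im z ^+ 2.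
Proof. by case: z => x y /=; rewrite sqr_sqrtr // addr_ge0 ?sqr_ge0. Qed.

Lemma normc_ge0 (z : R[i]) : 0 <= normc z.
Proof. by case: z => x y; exact: sqrtr_ge0. Qed.

Lemma normc_real (x : R) : normc (x%:C) = `|x|.
Proof. by rewrite /= expr0n addr0 sqrtr_sqr. Qed.

Lemma normc_gt0 (z : R[i]) : (0 < normc z) = (z != 0).
Proof.
rewrite lt_neqAle normc_ge0 andbT eq_sym; congr negb.
by apply/eqP/eqP => [/Normc.eq0_normc//|->]; exact: Normc.normc0.
Qed.

(** On the circle z^2 + b z + c has the modulus of z + b + c / z, whose imaginary
    part is (1 - c) Im z. *)
Lemma sqr_normc_char (b c : R) (z : R[i]) : normc z = 1 ->
  normc (z ^+ 2 + b%:C * z + c%:C) ^+ 2 = char_modulus2 b c (complex.Re z).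
Proof.
move=> z1; have := sqr_normcE z; rewrite z1 expr1n sqr_normcE.
case: z z1 => x y _ /= xy.
rewrite /char_modulus2.
transitivity ((x ^+ 2 - y ^+ 2 + b * x + c) ^+ 2 + y ^+ 2 * (2 * x + b) ^+ 2).
  by ring.
have -> : y ^+ 2 = 1 - x ^+ 2 by rewrite xy; ring.
by ring.
Qed.

Lemma unit_circle_abscissa (z : R[i]) : normc z = 1 -> -1 <= complex.Re z <= 1.
Proof.
move=> z1; have := sqr_normcE z; rewrite z1 expr1n => e.
rewrite -ler_norml -(@expr_le1 _ 2) // real_normK ?num_real //.
by rewrite e lerDl sqr_ge0.
Qed.

Lemma unit_circle_lift (t : R) : -1 <= t <= 1 ->
  exists2 z : R[i], normc z = 1 & complex.Re z = t.
Proof.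
rewrite -ler_norml => t1.
exists (Complex t (Num.sqrt (1 - t ^+ 2))) => //=.
rewrite sqr_sqrtr ?subrKC ?sqrtr1 // subr_ge0.
by rewrite -(real_normK (num_real t)) expr_le1.
Qed.

Lemma real_root_leN1 (b c : R) : -1 < c -> 1 + c - b <= 0 ->
  exists2 x : R, x <= -1 & x ^+ 2 + b * x + c = 0.
Proof.
move=> c1 bc.
have d0 : 0 <= b ^+ 2 - 4 * c by have := sqr_ge0 (1 - c); nra.
have s2 := sqr_sqrtr d0; have s0 := sqrtr_ge0 (b ^+ 2 - 4 * c).
move: s2 s0; set s := Num.sqrt _ => s2 s0.
exists (- (b + s) / 2).
  have [b2|b2] := leP 2 b; first by lra.
  suff : 2 - b <= s by lra.
  by rewrite -(@ler_pXn2r _ 2) ?nnegrE //; nra.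
transitivity ((s ^+ 2 - b ^+ 2 + 4 * c) / 4); first by field.
by rewrite s2; field.
Qed.

(** c is the product of the two roots; and 1 + b + c <= 0 or 1 - b + c <= 0 gives
    a real root outside the open disk by the intermediate value principle, made
    explicit in [real_root_leN1]. *)
Lemma schur_of_roots (b c : R) :
  (forall z : R[i], z ^+ 2 + b%:C * z + c%:C = 0 -> normc z < 1) -> schur b c.
Proof.
move=> rt.
have c1 : `|c| < 1.
  pose s : R[i] := sqrtc ((b ^+ 2 - 4 * c)%:C).
  have s2 : s ^+ 2 = b%:C ^+ 2 - 4 * c%:C.
    by rewrite sqr_sqrtc rmorphB rmorphXn rmorphM rmorph_nat.
  have r1 : normc ((- b%:C + s) / 2) < 1.
    by apply: rt; transitivity ((s ^+ 2 - b%:C ^+ 2 + 4 * c%:C) / 4);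
      [field | rewrite s2; field].
  have r2 : normc ((- b%:C - s) / 2) < 1.
    by apply: rt; transitivity ((s ^+ 2 - b%:C ^+ 2 + 4 * c%:C) / 4);
      [field | rewrite s2; field].
  rewrite -normc_real.
  have -> : c%:C = ((- b%:C + s) / 2) * ((- b%:C - s) / 2).
    by transitivity ((b%:C ^+ 2 - s ^+ 2) / 4); [rewrite s2; field | field].
  by rewrite Normc.normcM mulr_ilt1 ?normc_ge0.
move: c1; rewrite ltr_norml => /andP[c1 c2].
have real_rt (x : R) : x ^+ 2 + b * x + c = 0 -> `|x| < 1.
  move=> e; rewrite -normc_real; apply: rt.
  transitivity ((x ^+ 2 + b * x + c)%:C); last by rewrite e.
  by rewrite !rmorphD rmorphXn rmorphM.
split => //.
- rewrite ltNge; apply/negP => h.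
  have h' : 1 + c - (- b) <= 0 by lra.
  have [x x1 e] := real_root_leN1 c1 h'.
  have := real_rt (- x); rewrite normrN => /(_ _) n1.
  have : `|x| < 1 by apply: n1; rewrite -[RHS]e; ring.
  by rewrite ltr_norml; lra.
- rewrite ltNge; apply/negP => h.
  have h' : 1 + c - b <= 0 by lra.
  have [x x1 e] := real_root_leN1 c1 h'.
  by have := real_rt _ e; rewrite ltr_norml; lra.
Qed.

End ComplexModulus.

Section EuclideanNorms.
Variable R : realType.

Lemma sqr_l2norm n (v : 'cV[R]_n) : l2norm v ^+ 2 = \sum_i v i 0 ^+ 2.
Proof. by rewrite sqr_sqrtr // sumr_ge0 // => i _; exact: sqr_ge0. Qed.

Lemma sqr_l2normC n (v : 'cV[R[i]]_n) :
  l2normC v ^+ 2 = \sum_i normc (v i 0) ^+ 2.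
Proof. by rewrite sqr_sqrtr // sumr_ge0 // => i _; exact: sqr_ge0. Qed.

Lemma sum_sqr_mulmx m n (O : 'M[R]_(m, n)) (v : 'cV[R]_n) : O^T *m O = 1%:M ->
  \sum_i (O *m v) i 0 ^+ 2 = \sum_i v i 0 ^+ 2.
Proof.
move=> OO.
have ip k (x : 'cV[R]_k) : \sum_i x i 0 ^+ 2 = (x^T *m x) 0 0.
  by rewrite mxE; apply: eq_bigr => i _; rewrite mxE expr2.
by rewrite !ip trmx_mul mulmxA -(mulmxA v^T) OO mulmx1.
Qed.

Lemma ReD (x y : R[i]) : complex.Re (x + y) = complex.Re x + complex.Re y.
Proof. by case: x; case: y. Qed.
Lemma ImD (x y : R[i]) : complex.Im (x + y) = complex.Im x + complex.Im y.
Proof. by case: x; case: y. Qed.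

(** A real matrix acts separately on real and imaginary parts, so that isometries
    of the real space are isometries of the complex one. *)
Lemma Re_mul_toC m n (M : 'M[R]_(m, n)) (v : 'cV[R[i]]_n) i :
  complex.Re ((toC M *m v) i 0) = (M *m map_mx (@complex.Re R) v) i 0.
Proof.
rewrite !mxE (big_morph _ ReD (erefl _)); apply: eq_bigr => j _.
by rewrite !mxE; case: (v j 0) => x y /=; rewrite mul0r subr0.
Qed.

Lemma Im_mul_toC m n (M : 'M[R]_(m, n)) (v : 'cV[R[i]]_n) i :
  complex.Im ((toC M *m v) i 0) = (M *m map_mx (@complex.Im R) v) i 0.
Proof.
rewrite !mxE (big_morph _ ImD (erefl _)); apply: eq_bigr => j _.
by rewrite !mxE; case: (v j 0) => x y /=; rewrite mul0r addr0.
Qed.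

Lemma l2normC_isometry m n (O : 'M[R]_(m, n)) (v : 'cV[R[i]]_n) :
  O^T *m O = 1%:M -> l2normC (toC O *m v) = l2normC v.
Proof.
move=> OO; rewrite /l2normC; congr Num.sqrt.
have spl k (x : 'cV[R[i]]_k) : \sum_i normc (x i 0) ^+ 2 =
   \sum_i complex.Re (x i 0) ^+ 2 + \sum_i complex.Im (x i 0) ^+ 2.
  by rewrite -big_split /=; apply: eq_bigr => i _; exact: sqr_normcE.
rewrite !spl; congr (_ + _).
  under eq_bigr do rewrite Re_mul_toC.
  by rewrite sum_sqr_mulmx //; apply: eq_bigr => i _; rewrite mxE.
under eq_bigr do rewrite Im_mul_toC.
by rewrite sum_sqr_mulmx //; apply: eq_bigr => i _; rewrite mxE.
Qed.

Lemma l2normC_delta n (i : 'I_n) : l2normC (delta_mx i 0 : 'cV[R[i]]_n) = 1.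
Proof.
rewrite /l2normC (bigD1 i) //= mxE !eqxx Normc.normc1 expr1n big1 ?addr0 ?sqrtr1 //.
by move=> j /negbTE ji; rewrite mxE ji andFb mulr0n Normc.normc0 expr0n.
Qed.

(** The norm is attained at the preimage under O of a coordinate vector. *)
Lemma spectral_norm_diag_isometry n (D : 'rV[R[i]]_n) (O : 'M[R]_n) (i0 : 'I_n) :
  O^T *m O = 1%:M -> (forall i, normc (D 0 i) <= normc (D 0 i0)) ->
  spectral_norm (diag_mx D *m toC O) = normc (D 0 i0).
Proof.
move=> OO Dmax; have OO' := mulmx1C OO.
have gain v : l2normC (diag_mx D *m toC O *m v) <= normc (D 0 i0) * l2normC v.
  rewrite -(l2normC_isometry v OO) -mulmxA; move: (toC O *m v) => u.
  rewrite -(@ler_pXn2r _ 2) ?nnegrE ?sqrtr_ge0 ?mulr_ge0 ?normc_ge0 ?sqrtr_ge0 //.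
  rewrite exprMn !sqr_l2normC mulr_sumr ler_sum // => i _.
  rewrite mul_diag_mx mxE Normc.normcM exprMn ler_wpM2r ?sqr_ge0 //.
  by rewrite ler_pXn2r ?nnegrE ?normc_ge0.
rewrite /spectral_norm; set S := (X in sup X = _).
have ubS : ubound S (normc (D 0 i0)).
  move=> _ [v /= v1 <-]; apply: le_trans (gain v) _.
  by rewrite ler_piMr ?normc_ge0.
apply/eqP; rewrite eq_le; apply/andP; split.
  apply: ge_sup => //; exists (l2normC (diag_mx D *m toC O *m 0)), 0 => //=.
  by rewrite /l2normC big1 ?sqrtr0 ?ler01 // => i _; rewrite mxE Normc.normc0 expr0n.
apply: ub_le_sup; first by exists (normc (D 0 i0)).
exists (toC O^T *m delta_mx i0 0) => /=.
  by rewrite l2normC_isometry ?trmxK // l2normC_delta.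
rewrite -mulmxA (mulmxA (toC O)) -map_mxM OO' map_mx1 mul1mx mul_diag_mx.
rewrite /l2normC (bigD1 i0) //= big1 ?addr0 => [|i /negbTE ii0]; last first.
  by rewrite !mxE ii0 andFb mulr0n mulr0 Normc.normc0 expr0n.
by rewrite !mxE !eqxx mulr1 sqrtr_sqr ger0_norm ?normc_ge0.
Qed.

End EuclideanNorms.

(** * The transfer matrix in the eigenbasis *)

Section SpectralRadius.
Variable R : realType.

(** The supremum in [spectral_radius] is over a bounded set, since the eigenvalues
    are the finitely many roots of the characteristic polynomial. *)
Lemma normc_le_spectral_radius n (A : 'M[R]_n) (z : R[i]) :
  eigenvalue (toC A) z -> normc z <= spectral_radius A.
Proof.
move=> ez; apply: ub_le_sup; last by exists z.
have [rs rsE] := closed_field_poly_normal (char_poly (toC A)).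
exists (\sum_(x <- rs) normc x) => _ [x /= ex <-].
move: ex; rewrite eigenvalue_root_char rsE (monicP (char_poly_monic _)) scale1r.
rewrite root_prod_XsubC => xrs.
by rewrite (big_rem x) //= lerDl sumr_ge0 // => y _; exact: normc_ge0.
Qed.

End SpectralRadius.

Section Modes.
Variables (R : realType) (d : nat) (Q U : 'M[R]_d) (Lam : 'rV[R]_d).
Variables (alpha beta nu : R).

Local Notation b := (b_lam alpha beta nu).
Local Notation c := (c_lam alpha beta nu).
Local Notation A := (A_mx Q alpha beta nu).

Definition mode_char (lam : R) (z : R[i]) : R[i] :=
  z ^+ 2 + (b lam)%:C * z + (c lam)%:C.

(** A row eigenvector v of Q gives the row eigenvector (v, (z + b) v) of A. *)
Lemma eigenvalue_A_mx (lam : R) (z : R[i]) :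
  eigenvalue Q lam -> mode_char lam z = 0 -> eigenvalue (toC A) z.
Proof.
move=> /eigenvalueP[v vQ v0] chi0; apply/eigenvalueP.
pose vC := toC v.
have vCQ : vC *m toC Q = lam%:C *: vC by rewrite -map_mxM vQ map_mxZ.
exists (row_mx vC ((z + (b lam)%:C) *: vC)); last first.
  apply/eqP => /(congr1 lsubmx); rewrite row_mxKl linear0 => /eqP.
  by rewrite map_mx_eq0; exact/negP.
rewrite /A_mx /toC map_block_mx mul_row_block -/(toC _).
rewrite map_mx1 map_mx0 mulmx0 addr0 mulmx1 scale_row_mx.
congr row_mx.
  rewrite /toC map_mxB map_mxZ map_scalar_mx -/(toC Q).
  rewrite mulmxBr -scalemxAr vCQ mul_mx_scalar !scalerA -scalerBl -scalerDl.
  congr (_ *: _); rewrite /b_lam !(rmorphB, rmorphD, rmorphM, rmorph1); ring.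
rewrite map_mxD map_mxN map_mxZ map_scalar_mx -/(toC Q).
rewrite mulmxDr mulmxN -scalemxAr vCQ mul_mx_scalar !scalerA -scaleNr -scalerDl.
congr (_ *: _); apply/eqP; rewrite eq_sym -subr_eq0; apply/eqP.
rewrite -[RHS]chi0 /mode_char /c_lam !(rmorphB, rmorphD, rmorphM, rmorph1).
by ring.
Qed.

Lemma stable_schur (lam : R) : spectral_radius A < 1 ->
  eigenvalue Q lam -> schur (b lam) (c lam).
Proof.
move=> rho elam; apply: schur_of_roots => z chi0.
exact: le_lt_trans (normc_le_spectral_radius (eigenvalue_A_mx elam chi0)) rho.
Qed.

Hypothesis Qdec : orthogonal_eigendecomposition Q U Lam.

Lemma eigenvalue_Lam i : eigenvalue Q (Lam 0 i).
Proof.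
case: Qdec => UU QE _; apply/eigenvalueP; exists (row i U^T).
  rewrite QE -row_mul mulmxA mulmxA UU mul1mx.
  by apply/rowP => j; rewrite mul_diag_mx !mxE.
apply/eqP => r0; have : row i (U^T *m U) = 0 by rewrite row_mul r0 mul0mx.
rewrite UU => /rowP/(_ i); rewrite !mxE eqxx => /eqP.
by rewrite oner_eq0.
Qed.

Lemma eigenvalue_eq_Lam lam : eigenvalue Q lam -> exists i, lam = Lam 0 i.
Proof.
case: Qdec => UU QE _ /eigenvalueP[v vQ v0].
have UU' := mulmx1C UU.
have yD : v *m U *m diag_mx Lam = lam *: (v *m U).
  by rewrite scalemxAl -vQ QE !mulmxA -(mulmxA _ U^T) UU mulmx1.
have [i yi] : exists i, (v *m U) 0 i != 0.
  apply/rV0Pn; apply: contraNneq v0 => y0.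
  by rewrite -[v]mulmx1 -UU' mulmxA y0 mul0mx.
exists i; move/rowP: yD => /(_ i); rewrite mul_mx_diag mxE [RHS]mxE mulrC.
by move/(mulIf yi).
Qed.

(** The resolvent applied to B is the block column (z Y, Y), where Y solves the
    second-order equation chi(z) Y = - alpha, diagonal in the eigenbasis of Q. *)
Lemma transferE (z : R[i]) : z%:M - toC A \in unitmx ->
  (forall i, mode_char (Lam 0 i) z != 0) ->
  transfer Q U Lam alpha beta nu z =
  diag_mx (\row_i (- (alpha / Num.sqrt 2 * Num.sqrt (Lam 0 i))%:C
                   * z / mode_char (Lam 0 i) z)) *m toC U^T.
Proof.
case: Qdec => UU QE _ Munit chi0.
have UU' := mulmx1C UU.
pose V := toC U; pose W := toC U^T; pose D := diag_mx (map_mx (real_complex R) Lam).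
have WV : W *m V = 1%:M by rewrite /W /V /toC -map_mxM UU map_mx1.
have VW : V *m W = 1%:M by rewrite /W /V /toC -map_mxM UU' map_mx1.
have QC : toC Q = V *m D *m W by rewrite QE /toC !map_mxM map_diag_mx.
pose e : 'rV[R[i]]_d := \row_i (- alpha%:C / mode_char (Lam 0 i) z).
pose Y := V *m diag_mx e *m W.
have QY : toC Q *m Y = V *m (D *m diag_mx e) *m W.
  by rewrite QC /Y !mulmxA -(mulmxA _ W V) WV mulmx1.
have resolvent : invmx (z%:M - toC A) *m toC (B_mx d alpha) = col_mx (z *: Y) Y.
  suff <- : (z%:M - toC A) *m col_mx (z *: Y) Y = toC (B_mx d alpha).
    by rewrite mulmxA mulVmx // mul1mx.
  rewrite /A_mx /B_mx /toC map_block_mx map_col_mx map_mx1 !map_mx0.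
  rewrite scalar_mx_block opp_block_mx add_block_mx mul_block_col.
  rewrite !map_mxD !map_mxN !map_mxZ !map_scalar_mx -/(toC Q) /=.
  congr col_mx; last by rewrite add0r subr0 mulNmx mul1mx mul_scalar_mx addNr.
  have -> : - (alpha%:C)%:M = V *m (- (alpha%:C)%:M) *m W.
    by rewrite mulmxN mulNmx mul_mx_scalar -scalemxAl VW scalemx1.
  rewrite !(mulmxDl, mulNmx, mul_scalar_mx, =^~scalemxAl, =^~scalemxAr, opprD, opprK, add0r).
  rewrite QY /Y.
  have sc k X : k *: (V *m X *m W) = V *m (k *: X) *m W.
    by rewrite -scalemxAr -scalemxAl.
  have op X : - (V *m X *m W) = V *m (- X) *m W by rewrite mulmxN mulNmx.
  have ad X1 X2 : V *m X1 *m W + V *m X2 *m W = V *m (X1 + X2) *m W.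
    by rewrite mulmxDr mulmxDl.
  rewrite mul0mx add0r !(sc, op, ad).
  congr (_ *m _ *m _); apply/matrixP => i j.
  rewrite !mul_diag_mx !mxE; case: eqP => [->|_]; last first.
    by rewrite ?mulr0n ?(mulr0, oppr0, addr0, subr0).
  rewrite !mulr1n; have := chi0 j; rewrite /mode_char /b_lam /c_lam.
  rewrite !(rmorphB, rmorphD, rmorphM, rmorph1) => cj0.
  by field.
rewrite /transfer -mulmxA resolvent /T_mx /toC map_row_mx map_mx0 mul_row_col mul0mx addr0.
rewrite map_mxZ map_mxM -/(toC _) map_diag_mx -/W.
rewrite /Y -!scalemxAl -scalemxAr !mulmxA -(mulmxA _ W V) WV mulmx1.
rewrite !scalemxAl; congr (_ *m _); apply/matrixP => i j.
rewrite mul_mx_diag !mxE; case: eqP => [->|_]; last by rewrite ?mulr0n ?(mulr0, mul0r).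
rewrite !mulr1n !rmorphM /=.
by ring.
Qed.

Lemma unit_circle_unitmx (z : R[i]) : spectral_radius A < 1 -> normc z = 1 ->
  z%:M - toC A \in unitmx.
Proof.
move=> rho z1; have : ~~ eigenvalue (toC A) z.
  by apply/negP => /normc_le_spectral_radius; rewrite z1 leNgt rho.
rewrite /eigenvalue negbK kermx_eq0 row_free_unit.
by rewrite -opprB -scaleN1r unitmxZ ?unitrN1.
Qed.

End Modes.

(** * Nonnegative series, quadratic functions and energy of a mode *)

Section NonnegativeSeries.
Variables (R : realType) (f : nat -> R).
Hypothesis f_ge0 : forall k, 0 <= f k.

Let fE_ge0 k : (0 <= (f k)%:E)%E. Proof. by rewrite lee_fin. Qed.

Lemma nneseries_fin_le (B : R) : (forall N, \sum_(0 <= k < N) f k <= B) ->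
  (\sum_(0 <= k <oo) (f k)%:E <= B%:E)%E.
Proof.
move=> fB; apply: lime_le; first by apply: is_cvg_nneseries => n _ _; exact: fE_ge0.
by apply: nearW => N; rewrite sumEFin lee_fin.
Qed.

Lemma nneseries_fin_ge (N : nat) :
  ((\sum_(0 <= k < N) f k)%:E <= \sum_(0 <= k <oo) (f k)%:E)%E.
Proof.
rewrite -sumEFin; apply: (@nneseries_lim_ge R (fun k => (f k)%:E) xpredT 0 N).
by move=> n _ _; exact: fE_ge0.
Qed.

End NonnegativeSeries.

Section Quadratic.
Variables (R : realType) (d : nat) (Q : 'M[R]_d) (p : 'cV[R]_d) (r : R).
Hypothesis Qsym : Q^T = Q.

Local Notation f := (quadratic Q p r).

Lemma quadratic_expansion (x v : 'cV[R]_d) (h : R) :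
  f (h *: v + x) = f x + h * (v^T *m (Q *m x + p)) 0 0
                   + h ^+ 2 / 2 * (v^T *m Q *m v) 0 0.
Proof.
rewrite /quadratic.
have e1 : (x^T *m Q *m v) 0 0 = (v^T *m Q *m x) 0 0.
  transitivity ((x^T *m Q *m v)^T 0 0); first by rewrite [RHS]mxE.
  by rewrite !trmx_mul trmxK Qsym mulmxA.
have e2 : (p^T *m v) 0 0 = (v^T *m p) 0 0.
  transitivity ((p^T *m v)^T 0 0); first by rewrite [RHS]mxE.
  by rewrite trmx_mul trmxK.
have addE (M N : 'M[R]_1) : (M + N) 0 0 = M 0 0 + N 0 0 by rewrite mxE.
have scaleE k (M : 'M[R]_1) : (k *: M) 0 0 = k * M 0 0 by rewrite mxE.
have -> : (h *: v + x)^T = h *: v^T + x^T by rewrite linearD linearZ.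
rewrite !(mulmxDl, mulmxDr, =^~scalemxAl, =^~scalemxAr).
rewrite !mulmxA.
by rewrite !(addE, scaleE) e1 e2; field.
Qed.

(** By the exact second-order expansion the difference quotient is affine in h. *)
Lemma gradient_quadratic (x : 'cV[R]_d) : gradient f x = Q *m x + p.
Proof.
apply/colP => i; rewrite mxE; set v : 'cV[R]_d := delta_mx i 0.
have -> : (Q *m x + p) i 0 = (v^T *m (Q *m x + p)) 0 0.
  by rewrite trmx_delta -rowE [RHS]mxE.
set l := (_ *m _) 0 0; set k := (v^T *m Q *m v) 0 0.
apply: cvg_lim => //.
apply: (@cvg_trans _ ((fun h : R => l + h * (2^-1 * k)) @ 0^')); last first.
  apply: cvg_trans (_ : (fun h : R => l + h * (2^-1 * k)) @ nbhs 0 --> l).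
    by apply: cvg_app; exact: cvg_within.
  rewrite -[X in _ --> X](_ : l + 0 * (2^-1 * k) = l); last by rewrite mul0r addr0.
  by apply: cvgD; [exact: cvg_cst | apply: cvgMl; exact: cvg_id].
apply: near_eq_cvg; near=> h.
have h0 : h != 0 by near: h; exact: nbhs_dnbhs_neq.
rewrite /= quadratic_expansion -/l -/k /GRing.scale /=; field.
Unshelve. all: by end_near.
Qed.

(** Otherwise the exact line search step along the negative gradient would
    decrease f. *)
Lemma gradient_minimizer (xs : 'cV[R]_d) : posdefmx Q ->
  (forall x, f xs <= f x) -> Q *m xs + p = 0.
Proof.
move=> Qpd xsP; apply/eqP; apply/negPn/negP => g0.
set g := _ + p in g0.
have gg : 0 < (g^T *m g) 0 0.
  rewrite mxE; move/cV0Pn: g0 => [i gi].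
  rewrite (bigD1 i) //= ltr_pwDl // ?sumr_ge0 // => [|j _];
    by rewrite mxE -expr2 ?exprn_even_gt0 ?sqr_ge0.
have gQ := Qpd _ g0.
have := xsP (- ((g^T *m g) 0 0 / (g^T *m Q *m g) 0 0) *: g + xs).
rewrite quadratic_expansion -/g.
move: gg gQ; move: ((g^T *m g) 0 0) ((g^T *m Q *m g) 0 0) => a q a0 q0.
apply/negP; rewrite -ltNge.
suff -> : f xs + - (a / q) * a + (- (a / q)) ^+ 2 / 2 * q = f xs - a ^+ 2 / (2 * q).
  by rewrite gtrDl oppr_lt0 divr_gt0 ?exprn_gt0 ?mulr_gt0.
by field; lra.
Qed.

Lemma quadratic_gap (U : 'M[R]_d) (Lam : 'rV[R]_d) (xs x : 'cV[R]_d) :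
  Q = U *m diag_mx Lam *m U^T -> Q *m xs + p = 0 ->
  f x - f xs = 2^-1 * \sum_i Lam 0 i * (U^T *m (x - xs)) i 0 ^+ 2.
Proof.
move=> QE g0; have := quadratic_expansion xs (x - xs) 1.
rewrite scale1r subrK g0 mulmx0 mxE mulr0 addr0 expr1n mul1r => ->.
rewrite addrC addKr; congr (_ * _); rewrite {1}QE.
have -> : (x - xs)^T *m (U *m diag_mx Lam *m U^T) *m (x - xs) =
   (U^T *m (x - xs))^T *m (diag_mx Lam *m (U^T *m (x - xs))).
  by rewrite trmx_mul trmxK !mulmxA.
move: (U^T *m _) => y; rewrite mxE; apply: eq_bigr => i _.
by rewrite mul_diag_mx !mxE mulrCA expr2.
Qed.

End Quadratic.

Section Dissipation.
Variables (R : realType) (b c : R).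

(** Summing the dissipation inequality, the storage telescopes; its final value is
    nonnegative and its initial value is a multiple of y_0^2 as y_{-1} = y_0. *)
Lemma mode_energy_bound : schur b c -> exists2 K : R, 0 <= K &
  forall y yprev : nat -> R, yprev 0%N = y 0%N -> (forall k, yprev k.+1 = y k) ->
  forall N, char_min_modulus b c ^+ 2 * \sum_(0 <= k < N) y k ^+ 2 <=
    \sum_(0 <= k < N) (y k.+1 + b * y k + c * yprev k) ^+ 2 + K * y 0%N ^+ 2.
Proof.
move=> S; have [A [B [C [V_ge0 dissip]]]] := storage_function S.
exists (A + 2 * B + C); first by have := V_ge0 1 1; lra.
move=> y yp yp0 ypS N.
pose V k := A * y k ^+ 2 + 2 * B * y k * yp k + C * yp k ^+ 2.
suff : char_min_modulus b c ^+ 2 * \sum_(0 <= k < N) y k ^+ 2 + V N <=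
   \sum_(0 <= k < N) (y k.+1 + b * y k + c * yp k) ^+ 2 + V 0%N.
  have -> : V 0%N = (A + 2 * B + C) * y 0%N ^+ 2 by rewrite /V yp0; ring.
  by apply: le_trans; rewrite lerDl; exact: V_ge0.
elim: N => [|N IH]; first by rewrite !big_nil mulr0 !add0r.
rewrite !big_nat_recr //= mulrDr.
have := dissip (y N.+1) (y N) (yp N); rewrite -/(V N).
have -> : A * y N.+1 ^+ 2 + 2 * B * y N.+1 * y N + C * y N ^+ 2 = V N.+1.
  by rewrite /V ypS.
by lra.
Qed.

End Dissipation.

(** * Gain inequalities for the trajectories *)

Section Gain.
Variables (R : realType) (d : nat) (Q : 'M[R]_d) (p : 'cV[R]_d) (r : R).
Variables (U : 'M[R]_d) (Lam : 'rV[R]_d) (xs : 'cV[R]_d) (alpha beta nu : R).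
Hypotheses (Qsym : Q^T = Q) (Qdec : orthogonal_eigendecomposition Q U Lam).
Hypothesis xs_crit : Q *m xs + p = 0.
Hypothesis Lam_ge0 : forall i, 0 <= Lam 0 i.

Local Notation f := (quadratic Q p r).
Local Notation b i := (b_lam alpha beta nu (Lam 0 i)).
Local Notation c i := (c_lam alpha beta nu (Lam 0 i)).
Local Notation traj := (gmm f alpha beta nu).

Let UtU : U^T *m U = 1%:M. Proof. by case: Qdec. Qed.
Let UUt : U *m U^T = 1%:M. Proof. exact: mulmx1C UtU. Qed.
Let QE : Q = U *m diag_mx Lam *m U^T. Proof. by case: Qdec. Qed.

Definition gmm_prev (w : nat -> 'cV[R]_d) x0 k := (gmm_state f alpha beta nu w x0 k).2.

Lemma gmmS w x0 k : traj w x0 k.+1 - xs =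
  (1 + beta) *: (traj w x0 k - xs) - beta *: (gmm_prev w x0 k - xs)
  - (alpha * (1 + nu)) *: (Q *m (traj w x0 k - xs))
  + (alpha * nu) *: (Q *m (gmm_prev w x0 k - xs)) - alpha *: w k.
Proof.
rewrite /gmm /gmm_prev /=; case: (gmm_state _ _ _ _ _ _ _) => x xp /=.
rewrite gradient_quadratic //.
have pE : p = - (Q *m xs) by apply/eqP; rewrite -addr_eq0 addrC xs_crit.
rewrite pE !(mulmxDr, mulmxN, =^~scalemxAr).
move: (Q *m x) (Q *m xp) (Q *m xs) (w k) => Qx Qxp Qxs wk.
by apply/colP => j; rewrite !mxE; ring.
Qed.

Lemma gmm_prevS w x0 k : gmm_prev w x0 k.+1 = traj w x0 k.
Proof.
by rewrite /gmm /gmm_prev /=; case: (gmm_state _ _ _ _ _ _ _).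
Qed.

Definition mode (x : 'cV[R]_d) i := (U^T *m (x - xs)) i 0.

Lemma gmm_mode w x0 i k : mode (traj w x0 k.+1) i + b i * mode (traj w x0 k) i
  + c i * mode (gmm_prev w x0 k) i = - alpha * (U^T *m w k) i 0.
Proof.
have UQ (x : 'cV[R]_d) : (U^T *m (Q *m x)) i 0 = Lam 0 i * (U^T *m x) i 0.
  by rewrite QE !mulmxA UtU mul1mx -mulmxA mul_diag_mx mxE.
have addE (M N : 'cV[R]_d) : (M + N) i 0 = M i 0 + N i 0 by rewrite mxE.
have oppE (M : 'cV[R]_d) : (- M) i 0 = - M i 0 by rewrite mxE.
have scaleE k' (M : 'cV[R]_d) : (k' *: M) i 0 = k' * M i 0 by rewrite mxE.
rewrite /mode gmmS.
rewrite !(mulmxDr, mulmxN, =^~scalemxAr) !(addE, oppE, scaleE) !UQ.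
rewrite /b_lam /c_lam; ring.
Qed.

(** The scalar energy bounds add up because U is orthogonal; the function of x_0 is
    the total initial storage. *)
Lemma l2_gain_bound_of_modes (G : R) : alpha != 0 ->
  (forall i, schur (b i) (c i)) ->
  (forall i, alpha ^+ 2 * (Lam 0 i / 2) <= G ^+ 2 * char_min_modulus (b i) (c i) ^+ 2) ->
  l2_gain_bound f alpha beta nu xs G.
Proof.
move=> a0 S Gle.
have [K K0 KP] := fin_all_exists2 (fun i => mode_energy_bound (S i)).
pose H x := G ^+ 2 / alpha ^+ 2 * \sum_i K i * mode x i ^+ 2.
have gapE x : f x - f xs = 2^-1 * \sum_i Lam 0 i * mode x i ^+ 2.
  exact: quadratic_gap.
have gap_ge0 x : 0 <= f x - f xs.
  rewrite gapE mulr_ge0 ?invr_ge0 //.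
  by rewrite sumr_ge0 // => i _; rewrite mulr_ge0 ?sqr_ge0.
exists H; split.
- move=> x; rewrite mulr_ge0 ?divr_ge0 ?sqr_ge0 // sumr_ge0 // => i _.
  by rewrite mulr_ge0 ?sqr_ge0.
- rewrite /H big1 ?mulr0 // => i _.
  by rewrite /mode subrr mulmx0 mxE expr0n mulr0.
move=> x0 w wl2.
have w_ge0 k : 0 <= l2norm (w k) ^+ 2 by exact: sqr_ge0.
have wS N := nneseries_fin_ge w_ge0 N.
move: wl2 wS; rewrite /square_summable.
have : (0 <= \sum_(0 <= k <oo) (l2norm (w k) ^+ 2)%:E)%E.
  by apply: nneseries_ge0 => k _ _; rewrite lee_fin.
case: (\sum_(0 <= k <oo) _)%E => [s| |] //= s0 _ wS.
rewrite -EFinM -EFinD; apply: nneseries_fin_le => [k|N]; first exact: gap_ge0.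
have {}wS : \sum_(0 <= k < N) l2norm (w k) ^+ 2 <= s by rewrite -lee_fin.
apply: le_trans (_ : G ^+ 2 * \sum_(0 <= k < N) l2norm (w k) ^+ 2 + H x0 <= _);
  last by rewrite lerD2r ler_wpM2l ?sqr_ge0.
have -> : \sum_(0 <= k < N) l2norm (w k) ^+ 2 =
   \sum_i \sum_(0 <= k < N) (U^T *m w k) i 0 ^+ 2.
  rewrite exchange_big /=; apply: eq_bigr => k _.
  by rewrite sqr_l2norm sum_sqr_mulmx // trmxK UUt.
under eq_bigr do rewrite gapE.
rewrite -mulr_sumr exchange_big /= /H !mulr_sumr -big_split /= ler_sum // => i _.
have := KP i (fun k => mode (traj w x0 k) i) (fun k => mode (gmm_prev w x0 k) i)
  (erefl _) (fun k => congr1 (mode^~ i) (gmm_prevS w x0 k)) N.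
under [X in _ <= X + _]eq_bigr do rewrite gmm_mode exprMn sqrrN.
rewrite -mulr_sumr -mulr_sumr /=.
have := Gle i.
have : 0 <= \sum_(0 <= k < N) mode (traj w x0 k) i ^+ 2.
  by rewrite sumr_ge0 // => k _; exact: sqr_ge0.
rewrite [mode (traj w x0 0) i]/(mode x0 i).
set Sy := \sum_(0 <= k < N) mode _ _ ^+ 2; set Sw := \sum_(0 <= k < N) _ ^+ 2.
move=> Sy0 h1 h2.
have a2 : 0 < alpha ^+ 2 by rewrite exprn_even_gt0.
rewrite -(ler_pM2l a2).
have -> : alpha ^+ 2 * (2^-1 * (Lam 0 i * Sy)) = (alpha ^+ 2 * (Lam 0 i / 2)) * Sy.
  by field.
have := ler_wpM2r Sy0 h1.
have := ler_wpM2l (sqr_ge0 G) h2.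
have -> : alpha ^+ 2 * (G ^+ 2 * Sw + G ^+ 2 / alpha ^+ 2 * (K i * mode x0 i ^+ 2))
  = G ^+ 2 * (alpha ^+ 2 * Sw + K i * mode x0 i ^+ 2) by field.
move=> h3 h4; apply: le_trans h4 _; rewrite -mulrA; exact: h3.
Qed.

(** Any scalar sequence starting at 0 is the trajectory of one mode: the recursion
    is solved for the error. *)
Lemma gmm_realize (u : nat -> R) i : alpha != 0 -> u 0%N = 0 ->
  let w k := (- (u k.+1 + b i * u k + c i * u k.-1) / alpha) *: col i U in
  forall k, traj w xs k - xs = u k *: col i U /\
            gmm_prev w xs k - xs = u k.-1 *: col i U.
Proof.
move=> a0 u0 w; elim=> [|k [IH1 IH2]].
  by rewrite u0 scale0r /gmm /gmm_prev /= subrr.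
split; last by rewrite gmm_prevS IH1.
have Qv : Q *m col i U = Lam 0 i *: col i U.
  rewrite QE colE -!mulmxA (mulmxA U^T) UtU mul1mx scalemxAr; congr (U *m _).
  by apply/colP => j; rewrite mul_diag_mx !mxE; case: eqP => [->|_]; rewrite ?mulr0.
rewrite gmmS IH1 IH2 -!scalemxAr Qv /w !scalerA -!(scalerBl, scalerDl).
congr (_ *: _); rewrite /b_lam /c_lam; by field.
Qed.

Lemma sum_finite_support_le (g : nat -> R) (M : nat) : (forall k, 0 <= g k) ->
  (forall k, (M <= k)%N -> g k = 0) ->
  forall N, \sum_(0 <= k < N) g k <= \sum_(0 <= k < M) g k.
Proof.
move=> g0 gM N; have [NM|MN] := leqP N M.
  by rewrite (big_cat_nat _ NM) //= lerDl sumr_ge0.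
have tail0 : \sum_(M <= k < N) g k = 0.
  by rewrite big_nat_cond big1 // => k /andP[/andP[Mk _] _]; exact: gM.
by rewrite (big_cat_nat _ (ltnW MN)) //= tail0 addr0.
Qed.

Lemma finite_input_gain (G : R) (u : nat -> R) i N : alpha != 0 ->
  l2_gain_bound f alpha beta nu xs G -> u 0%N = 0 ->
  (forall k, (N < k)%N -> u k = 0) ->
  alpha ^+ 2 * (Lam 0 i / 2) * \sum_(0 <= k < N.+1) u k ^+ 2 <=
  G ^+ 2 * \sum_(0 <= k < N.+2) (u k.+1 + b i * u k + c i * u k.-1) ^+ 2.
Proof.
move=> a0 [H [_ H0 HG]] u0 uN.
pose om k := u k.+1 + b i * u k + c i * u k.-1.
pose w k := (- om k / alpha) *: col i U.
have modeE k j : mode (traj w xs k) j = u k *+ (i == j).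
  rewrite /mode (gmm_realize i a0 u0 k).1 -scalemxAr colE mulmxA UtU mul1mx.
  by rewrite !mxE andbT mulr_natr eq_sym.
have wE k : l2norm (w k) ^+ 2 = om k ^+ 2 / alpha ^+ 2.
  have wkE : w k = U *m ((- om k / alpha) *: delta_mx i 0).
    by rewrite -scalemxAr -colE.
  rewrite sqr_l2norm wkE sum_sqr_mulmx // (bigD1 i) //= big1 ?addr0 => [|j /negbTE ji].
    by rewrite !mxE !eqxx mulr1 exprMn sqrrN exprVn.
  by rewrite !mxE ji mulr0 expr0n.
have w_ge0 k : 0 <= l2norm (w k) ^+ 2 by exact: sqr_ge0.
have omN k : (N.+2 <= k)%N -> l2norm (w k) ^+ 2 = 0.
  move=> Nk; rewrite wE /om !uN ?(mulr0, addr0, expr0n, mul0r) //; lia.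
have wsum := nneseries_fin_le w_ge0 (sum_finite_support_le w_ge0 omN).
have := HG xs w (le_lt_trans wsum (ltry _)).
rewrite H0 adde0 => gain.
have gapE k : f (traj w xs k) - f xs = Lam 0 i / 2 * u k ^+ 2.
  have -> := quadratic_gap r Qsym (traj w xs k) QE xs_crit.
  rewrite (bigD1 i) //= big1 => [|j /negbTE ji].
    by rewrite -/(mode _ i) modeE eqxx addr0 mulr1n; field.
  by rewrite -/(mode _ j) modeE eq_sym ji mulr0n expr0n mulr0.
have gap_ge0 k : 0 <= f (traj w xs k) - f xs.
  by rewrite gapE mulr_ge0 ?sqr_ge0 // divr_ge0.
have := le_trans (nneseries_fin_ge gap_ge0 N.+1) gain.
move/le_trans => /(_ _ (lee_wpmul2l _ wsum)); rewrite lee_fin => /(_ (sqr_ge0 _)).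
rewrite -EFinM lee_fin.
under eq_bigr do rewrite gapE.
under [X in _ <= _ * X]eq_bigr do rewrite wE.
rewrite -mulr_sumr -mulr_suml => h.
have a2 : 0 < alpha ^+ 2 by rewrite exprn_even_gt0.
rewrite -mulrA; have := ler_wpM2l (ltW a2) h.
by congr (_ <= _); rewrite /om; field.
Qed.

(** The real and imaginary parts of a complex sequence are two admissible real
    trajectories, whose energies add up to the squared moduli. *)
Lemma finite_input_gainC (G : R) (u : nat -> R[i]) i N : alpha != 0 ->
  l2_gain_bound f alpha beta nu xs G -> u 0%N = 0 ->
  (forall k, (N < k)%N -> u k = 0) ->
  alpha ^+ 2 * (Lam 0 i / 2) * \sum_(0 <= k < N.+1) normc (u k) ^+ 2 <=
  G ^+ 2 * \sum_(0 <= k < N.+2)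
    normc (u k.+1 + (b i)%:C * u k + (c i)%:C * u k.-1) ^+ 2.
Proof.
move=> a0 HG u0 uN.
have hRe : _ <= _ := @finite_input_gain G (fun k => complex.Re (u k)) i N a0 HG
  (congr1 (@complex.Re R) u0) (fun k kN => congr1 (@complex.Re R) (uN k kN)).
have hIm : _ <= _ := @finite_input_gain G (fun k => complex.Im (u k)) i N a0 HG
  (congr1 (@complex.Im R) u0) (fun k kN => congr1 (@complex.Im R) (uN k kN)).
have := lerD hRe hIm; rewrite -!mulrDr -!big_split /= => h.
under eq_bigr do rewrite sqr_normcE.
apply: le_trans h _.
rewrite ler_wpM2l ?sqr_ge0 //; apply: ler_sum => k _.
rewrite sqr_normcE.
by case: (u k.+1) (u k) (u k.-1) => [x1 y1] [x2 y2] [x3 y3] /=; lra.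
Qed.

(** Test the gain on z^k for 1 <= k <= n + 2. The output energy is proportional to
    n + 2, while each input term with 2 <= k <= n + 1 is |chi(z)|^2 and the four
    other ones are bounded by a constant C. *)
Lemma gain_ge_frequency (G : R) i (z : R[i]) : alpha != 0 ->
  l2_gain_bound f alpha beta nu xs G -> normc z = 1 ->
  alpha ^+ 2 * (Lam 0 i / 2) <=
  G ^+ 2 * normc (mode_char alpha beta nu (Lam 0 i) z) ^+ 2.
Proof.
move=> a0 HG z1; set rho := normc (mode_char _ _ _ _ _).
have zk k : normc (z ^+ k) = 1.
  elim: k => [|k IH]; first by rewrite expr0 Normc.normc1.
  by rewrite exprS Normc.normcM z1 IH mulr1.
pose C := (1 + `|b i| + `|c i|) ^+ 2.
suff bnd n : alpha ^+ 2 * (Lam 0 i / 2) * (n.+2)%:R <= G ^+ 2 * (n%:R * rho ^+ 2 + 4 * C).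
  set a := alpha ^+ 2 * _ in bnd *; set g := G ^+ 2 in bnd *.
  rewrite leNgt; apply/negP; rewrite -subr_gt0 => h.
  pose e := a - g * rho ^+ 2.
  (* The bound is affine in n on both sides, so the slopes compare. *)
  have [n hn] : exists n : nat, 4 * g * C - 2 * a < n%:R * e.
    exists (Num.bound `|(4 * g * C - 2 * a) / e|).
    rewrite -ltr_pdivrMr //; apply: le_lt_trans (ler_norm _) _.
    exact: archi_boundP.
  have := bnd n; rewrite -addn2 natrD leNgt => /negP; apply.
  by move: hn; rewrite /e; lra.
pose u k : R[i] := if (0 < k <= n.+2)%N then z ^+ k else 0.
have u0 : u 0%N = 0 by [].
have uN k : (n.+2 < k)%N -> u k = 0.
  by move=> nk; rewrite /u [(k <= _)%N]leqNgt nk andbF.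
have uk k : (0 < k <= n.+2)%N -> u k = z ^+ k by rewrite /u => ->.
have := finite_input_gainC i a0 HG u0 uN.
have -> : \sum_(0 <= k < n.+3) normc (u k) ^+ 2 = n.+2%:R.
  rewrite big_nat_recl // u0 Normc.normc0 expr0n add0r.
  rewrite (eq_big_nat _ _ (F2 := fun=> 1)) ?sumr_const_nat ?subn0 // => k kn.
  by rewrite uk ?zk ?expr1n //; lia.
set F := fun k => normc (u k.+1 + (b i)%:C * u k + (c i)%:C * u k.-1) ^+ 2.
have u1 k : normc (u k) <= 1.
  by rewrite /u; case: ifP => _; rewrite ?zk // Normc.normc0.
have FC k : F k <= C.
  rewrite /F /C (@ler_pXn2r _ 2) // ?nnegrE;
    [| exact: normc_ge0 | by rewrite !addr_ge0].
  apply: le_trans (le_normcD _ _) _; apply: lerD.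
    apply: le_trans (le_normcD _ _) _; apply: lerD => //.
    by rewrite Normc.normcM normc_real ler_piMr.
  by rewrite Normc.normcM normc_real ler_piMr.
have Fin k : (k < n)%N -> F k.+2 = rho ^+ 2.
  move=> kn; rewrite /F !uk /=; [|lia|lia|lia].
  rewrite /rho /mode_char.
  have -> : z ^+ k.+3 + (b i)%:C * z ^+ k.+2 + (c i)%:C * z ^+ k.+1 =
    z ^+ k.+1 * (z ^+ 2 + (b i)%:C * z + (c i)%:C) by rewrite !exprS; ring.
  by rewrite Normc.normcM zk mul1r.
move=> h; apply: le_trans h _; rewrite ler_wpM2l ?sqr_ge0 //.
rewrite -/F.
rewrite (_ : \sum_(0 <= k < n.+4) _ = \sum_(0 <= k < n.+4) F k) //.
rewrite big_nat_recr //= big_nat_recr //= big_nat_recl //= big_nat_recl //=.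
have -> : \sum_(0 <= k < n) F k.+2 = n%:R * rho ^+ 2.
  rewrite (eq_big_nat _ _ (F2 := fun=> rho ^+ 2)) => [|k kn]; last exact: Fin.
  by rewrite sumr_const_nat subn0 mulr_natl.
have := FC 0%N; have := FC 1%N; have := FC n.+2; have := FC n.+3; lra.
Qed.

End Gain.

(** * Peak gains and the worst-case robustness *)

Section PeakGain.
Variables (R : realType) (alpha beta nu : R).
Local Notation b := (b_lam alpha beta nu).
Local Notation c := (c_lam alpha beta nu).
Local Notation r_ := (r_lam alpha beta nu).

(** The largest modulus over the unit circle of the transfer function of a mode. *)
Definition peak_gain (lam : R) : R := alpha / Num.sqrt 2 * (Num.sqrt lam / r_ lam).

Lemma r_lam_gt0 lam : schur (b lam) (c lam) -> 0 < r_ lam.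
Proof. exact: char_min_modulus_gt0. Qed.

Lemma gain_level_le (lam G rho : R) : 0 < alpha -> 0 < lam -> 0 < rho -> 0 <= G ->
  (alpha / Num.sqrt 2 * (Num.sqrt lam / rho) <= G) =
  (alpha ^+ 2 * (lam / 2) <= G ^+ 2 * rho ^+ 2).
Proof.
move=> a0 l0 r0 G0.
have s2 : 0 < Num.sqrt (2 : R) by rewrite sqrtr_gt0.
rewrite -(@ler_pXn2r _ 2) // ?nnegrE; last first.
  by rewrite mulr_ge0 // divr_ge0 ?sqrtr_ge0 // ltW.
have -> : (alpha / Num.sqrt 2 * (Num.sqrt lam / rho)) ^+ 2 =
    alpha ^+ 2 * (lam / 2) / rho ^+ 2.
  by rewrite !(exprMn, exprVn) !sqr_sqrtr ?(ltW l0) //; field; lra.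
by rewrite ler_pdivrMr // exprn_gt0.
Qed.

Lemma peak_gain_ge0 lam : 0 < alpha -> schur (b lam) (c lam) -> 0 <= peak_gain lam.
Proof.
move=> a0 S; rewrite /peak_gain mulr_ge0 // divr_ge0 ?sqrtr_ge0 //; first exact: ltW.
exact/ltW/r_lam_gt0.
Qed.

(** Start from the worst frequency of lam and transport it to an end of the
    spectrum; the modulus there is at least the minimal one. *)
Lemma peak_gain_endpoint (l lam u : R) : 0 < alpha -> 0 <= nu -> 0 < l ->
  l <= lam -> lam <= u ->
  schur (b l) (c l) -> schur (b lam) (c lam) -> schur (b u) (c u) ->
  peak_gain lam <= Num.max (peak_gain l) (peak_gain u).
Proof.
move=> a0 nu0 l0 ll lu Sl S Su.
have lam0 : 0 < lam := lt_le_trans l0 ll.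
have u0 : 0 < u := lt_le_trans lam0 lu.
have [t /andP[t1 t2] tE] := char_min_modulus_attained S.
have [_ cl1 _ _] := Sl; have [_ _ _ bu1] := Su.
have cmp v : 0 < v -> schur (b v) (c v) -> (exists2 s', 0 <= s' <= 2 &
    scaled_modulus2 beta nu (alpha * v) s' <= scaled_modulus2 beta nu (alpha * lam) (1 - t)) ->
    peak_gain lam <= peak_gain v.
  move=> v0 Sv [s' /andP[s1 s2]]; rewrite /scaled_modulus2 subKr.
  rewrite -[mode_b _ _ (alpha * lam)]/(b lam) -[mode_c _ _ (alpha * lam)]/(c lam) tE.
  rewrite -[mode_b _ _ _]/(b v) -[mode_c _ _ _]/(c v) => le_v.
  have rv0 := r_lam_gt0 Sv; have rl0 := r_lam_gt0 S.
  rewrite gain_level_le ?peak_gain_ge0 //.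
  have -> : peak_gain v ^+ 2 = alpha ^+ 2 * (v / 2) / r_ v ^+ 2.
    rewrite /peak_gain !(exprMn, exprVn) !sqr_sqrtr ?(ltW v0) //; field; lra.
  have h1 : r_ v ^+ 2 <= char_modulus2 (b v) (c v) (1 - s').
    by apply: char_min_modulus_le => //; apply/andP; split; lra.
  have {}le_v : r_ v ^+ 2 / (alpha * v) <= r_ lam ^+ 2 / (alpha * lam).
    apply: le_trans le_v; apply: ler_wpM2r => //.
    by rewrite invr_ge0 mulr_ge0 // ltW.
  have k0 : 0 <= alpha ^+ 3 * lam * v / (2 * r_ v ^+ 2).
    by rewrite divr_ge0 ?mulr_ge0 ?sqr_ge0 ?exprn_ge0 // ltW.
  have := ler_wpM2l k0 le_v.
  congr (_ <= _); field; lra.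
have al x y : x <= y -> alpha * x <= alpha * y by move=> xy; rewrite ler_pM2l.
have Dl : mode_c beta nu (alpha * l) < 1 by [].
have yu : 0 <= 1 + mode_c beta nu (alpha * u) - mode_b beta nu (alpha * u).
  by rewrite subr_ge0; exact: ltW.
have [||s' s'b [h|h]] := scaled_modulus2_min_endpoint nu0 (mulr_gt0 a0 l0)
   (al _ _ ll) (al _ _ lu) Dl yu (s := 1 - t); rewrite ?le_max; try lra.
- by rewrite cmp //; exists s'.
- by rewrite (cmp u) ?orbT //; exists s'.
Qed.

Lemma peak_gain_le_best (lam mu : R) : 0 < alpha -> 0 < lam -> 0 < mu ->
  schur (b lam) (c lam) ->
  (peak_gain lam <= 1 / Num.sqrt (2 * mu)) = (alpha * Num.sqrt (lam * mu) <= r_ lam).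
Proof.
move=> a0 lam0 mu0 S; have r0 := r_lam_gt0 S.
rewrite gain_level_le ?divr_ge0 ?sqrtr_ge0 //.
rewrite -(@ler_pXn2r _ 2 _ (alpha * _)) // ?nnegrE ?(ltW r0) //; last first.
  by rewrite mulr_ge0 ?sqrtr_ge0 // ltW.
rewrite !(exprMn, exprVn) !sqr_sqrtr ?mulr_ge0 ?(ltW lam0) ?(ltW mu0) //.
rewrite expr1n mul1r mulrC ler_pdivlMl ?mulr_gt0 //.
by congr (_ <= _); field.
Qed.

(** The comparison with 1 / sqrt (2 mu) is the value at z = 1, where
    |chi(1)| = alpha mu. *)
Lemma best_le_peak_gain (mu : R) : 0 < alpha -> 0 < mu ->
  schur (b mu) (c mu) ->
  (1 / Num.sqrt (2 * mu) <= peak_gain mu) /\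
  (peak_gain mu = 1 / Num.sqrt (2 * mu) <-> r_ mu = alpha * mu).
Proof.
move=> a0 mu0 S; have r0 := r_lam_gt0 S.
have r_le : r_ mu <= alpha * mu.
  have -> : alpha * mu = 1 + b mu + c mu by rewrite /b_lam /c_lam; ring.
  exact: char_min_modulus_le1.
have smu : 0 < Num.sqrt mu by rewrite sqrtr_gt0.
have s2 : 0 < Num.sqrt (2 : R) by rewrite sqrtr_gt0.
have gE : peak_gain mu = (1 / Num.sqrt (2 * mu)) * (alpha * mu / r_ mu).
  have -> : alpha * mu = alpha * Num.sqrt mu ^+ 2 by rewrite sqr_sqrtr // ltW.
  rewrite /peak_gain sqrtrM //.
  by field; rewrite !gt_eqF.
have best0 : 0 < 1 / Num.sqrt (2 * mu) by rewrite divr_gt0 // sqrtr_gt0 mulr_gt0.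
rewrite gE; split; first by rewrite ler_peMr ?(ltW best0) // ler_pdivlMr ?mul1r.
split=> [/eqP|->].
  rewrite -[X in _ == X]mulr1 (inj_eq (mulfI (lt0r_neq0 best0))) => /eqP e.
  by rewrite -[LHS]mul1r -e divfK // gt_eqF.
by rewrite divff ?mulr1 // mulf_neq0 // gt_eqF.
Qed.

End PeakGain.

Section FrequencyGains.
Variables (R : realType) (d : nat) (Q U : 'M[R]_d) (Lam : 'rV[R]_d).
Variables (alpha beta nu : R).
Hypothesis Qdec : orthogonal_eigendecomposition Q U Lam.
Hypothesis stable : spectral_radius (A_mx Q alpha beta nu) < 1.
Hypothesis alpha_gt0 : 0 < alpha.
Hypothesis Lam_gt0 : forall i, 0 < Lam 0 i.

Local Notation chi i z := (mode_char alpha beta nu (Lam 0 i) z).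
Local Notation gain i z := (alpha / Num.sqrt 2 * (Num.sqrt (Lam 0 i) / normc (chi i z))).

Lemma mode_schur i : schur (b_lam alpha beta nu (Lam 0 i)) (c_lam alpha beta nu (Lam 0 i)).
Proof. by apply: stable_schur stable _; exact: eigenvalue_Lam Qdec i. Qed.

Lemma r_lam_le_char i (z : R[i]) : normc z = 1 ->
  r_lam alpha beta nu (Lam 0 i) <= normc (chi i z).
Proof.
move=> z1; rewrite -(@ler_pXn2r _ 2) // ?nnegrE ?normc_ge0 //; last first.
  exact/ltW/(r_lam_gt0 (mode_schur i)).
rewrite sqr_normc_char //.
by apply: char_min_modulus_le (mode_schur i) _; exact: unit_circle_abscissa.
Qed.

Lemma spectral_norm_transfer (z : R[i]) (i : 'I_d) : normc z = 1 ->
  exists2 j, spectral_norm (transfer Q U Lam alpha beta nu z) = gain j z &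
    forall k, gain k z <= gain j z.
Proof.
move=> z1.
have chi_gt0 k : 0 < normc (chi k z).
  exact: lt_le_trans (r_lam_gt0 (mode_schur k)) (r_lam_le_char k z1).
rewrite (transferE Qdec); last 2 first.
- exact: unit_circle_unitmx.
- by move=> k; rewrite -normc_gt0.
set D := \row_k _.
have DE k : normc (D 0 k) = gain k z.
  rewrite mxE !Normc.normcM normcN Normc.normcV z1 mulr1 normc_real ger0_norm.
    by rewrite mulrA.
  by rewrite mulr_ge0 ?sqrtr_ge0 // divr_ge0 ?sqrtr_ge0 // ltW.
case: (arg_maxP (fun k => gain k z) (isT : xpredT i)) => j _ jmax.
exists j; last by move=> k; exact: jmax.
rewrite -DE; apply: spectral_norm_diag_isometry.
  by case: Qdec => UU _ _; rewrite trmxK; exact: mulmx1C.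
by move=> k; rewrite !DE; exact: jmax.
Qed.

Lemma frequency_gains_max (j : 'I_d) :
  (forall i, peak_gain alpha beta nu (Lam 0 i) <= peak_gain alpha beta nu (Lam 0 j)) ->
  is_max (frequency_gains Q U Lam alpha beta nu) (peak_gain alpha beta nu (Lam 0 j)).
Proof.
move=> jmax.
have le_peak i z : normc z = 1 -> gain i z <= peak_gain alpha beta nu (Lam 0 j).
  move=> z1; apply: le_trans (jmax i); rewrite /peak_gain.
  apply: ler_wpM2l; first by rewrite divr_ge0 ?sqrtr_ge0 // ltW.
  apply: ler_wpM2l; first exact: sqrtr_ge0.
  have r0 := r_lam_gt0 (mode_schur i); have le := r_lam_le_char i z1.
  by rewrite lef_pV2 // posrE (lt_le_trans r0).
split; last first.
  by move=> _ [z /= z1 <-]; have [i -> _] := spectral_norm_transfer j z1; exact: le_peak.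
have [t t1 tE] := char_min_modulus_attained (mode_schur j).
have [z z1 zt] := unit_circle_lift t1.
exists z => //.
have gj : gain j z = peak_gain alpha beta nu (Lam 0 j).
  rewrite /peak_gain; congr (_ * (_ / _)); apply/eqP.
  rewrite -(@eqrXn2 _ 2) ?normc_ge0 //; last exact/ltW/(r_lam_gt0 (mode_schur j)).
  by rewrite sqr_normc_char // zt tE.
have [i -> imax] := spectral_norm_transfer j z1.
by apply/eqP; rewrite eq_le le_peak //= -gj.
Qed.

End FrequencyGains.

Lemma is_max_sup (R : realType) (S : set R) (m : R) : is_max S m -> sup S = m.
Proof.
move=> [Sm Sub]; apply/eqP; rewrite eq_le; apply/andP; split.
  by apply: ge_sup => //; exists m.
by apply: ub_le_sup => //; exists m.
Qed.

Theorem theorem4p1 (R : realType) (d : nat)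
    (Q : 'M[R]_d) (p : 'cV[R]_d) (r mu L : R)
    (U : 'M[R]_d) (Lam : 'rV[R]_d) (xs : 'cV[R]_d) (alpha beta nu : R)
    (Qsym : Q^T = Q) (Qpd : posdefmx Q)
    (muP : smallest_eigenvalue Q mu) (LP : largest_eigenvalue Q L)
    (mu_gt0 : 0 < mu) (mu_lt_L : mu < L)
    (Qdec : orthogonal_eigendecomposition Q U Lam)
    (xsP : forall x, quadratic Q p r xs <= quadratic Q p r x)
    (alpha_gt0 : 0 < alpha) (beta_ge0 : 0 <= beta) (nu_ge0 : 0 <= nu)
    (stable : spectral_radius (A_mx Q alpha beta nu) < 1) :
  let L2star := l2_gain (quadratic Q p r) alpha beta nu xs in
  let H := Hinf Q U Lam alpha beta nu in
  let best := 1 / Num.sqrt (2 * mu) in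
  [/\ is_max (frequency_gains Q U Lam alpha beta nu) H,
      L2star = H%:E,
      H = alpha / Num.sqrt 2 *
          Num.max (Num.sqrt mu / r_lam alpha beta nu mu)
                  (Num.sqrt L / r_lam alpha beta nu L),
      best <= H &
      (L2star = best%:E /\ H = best) <->
        (S1 mu `&` S2 mu L) (alpha, beta, nu)].
Proof.
move=> L2star H best.
have [emu mu_min] := muP; have [eL L_max] := LP.
have L_gt0 : 0 < L := lt_trans mu_gt0 mu_lt_L.
have alpha_neq0 : alpha != 0 by rewrite gt_eqF.
have xs_crit := gradient_minimizer Qsym Qpd xsP.
have Lam_bnd i : mu <= Lam 0 i /\ Lam 0 i <= L.
  by split; [apply: mu_min | apply: L_max]; exact: eigenvalue_Lam Qdec i.
have Lam_gt0 i : 0 < Lam 0 i by have [+ _] := Lam_bnd i; exact: lt_le_trans.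
have Smode := mode_schur Qdec stable.
have Smu := stable_schur stable emu; have SL := stable_schur stable eL.
pose g := peak_gain alpha beta nu.
have [im muE] := eigenvalue_eq_Lam Qdec emu.
have [iL LE] := eigenvalue_eq_Lam Qdec eL.
have gmax i : g (Lam 0 i) <= Num.max (g mu) (g L).
  by have [h1 h2] := Lam_bnd i; apply: peak_gain_endpoint.
have [j gj] : exists j, g (Lam 0 j) = Num.max (g mu) (g L).
  by rewrite /Num.max; case: ifP => _; [exists iL; rewrite -LE | exists im; rewrite -muE].
have Hmax : is_max (frequency_gains Q U Lam alpha beta nu) (g (Lam 0 j)).
  by apply: frequency_gains_max => // i; rewrite -/g gj.
have HE : H = g (Lam 0 j) := is_max_sup Hmax.
have rj0 := r_lam_gt0 (Smode j).
have H_gt0 : 0 < H by rewrite HE /g /peak_gain !(mulr_gt0, divr_gt0) ?invr_gt0 ?sqrtr_gt0.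
have L2E : L2star = H%:E.
  apply/eqP; rewrite eq_le; apply/andP; split.
    apply: ereal_inf_lbound; exists H => //; split=> //.
    apply: (l2_gain_bound_of_modes _ Qsym Qdec xs_crit) => // [i|i].
      exact: ltW.
    rewrite -gain_level_le ?(ltW H_gt0) //; last exact: r_lam_gt0.
    by rewrite HE gj; exact: gmax.
  apply: le_ereal_inf_tmp => _ [G [G_gt0 HG] <-]; rewrite lee_fin HE.
  rewrite /g /peak_gain gain_level_le ?(ltW G_gt0) //.
  have [t t1 tE] := char_min_modulus_attained (Smode j).
  have [z z1 zt] := unit_circle_lift t1.
  have := gain_ge_frequency Qsym Qdec xs_crit (fun i => ltW (Lam_gt0 i)) j alpha_neq0 HG z1.
  by rewrite sqr_normc_char // zt tE.
have [best_le bestP] := best_le_peak_gain alpha_gt0 mu_gt0 Smu.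
have Hg : H = Num.max (g mu) (g L) by rewrite HE.
split.
- by rewrite HE.
- exact: L2E.
- rewrite Hg maxr_pMr //; by rewrite divr_ge0 ?sqrtr_ge0 // ltW.
- by rewrite Hg le_max best_le.
rewrite L2E /=.
have gL : (g L <= best) = (alpha * Num.sqrt (L * mu) <= r_lam alpha beta nu L).
  exact: peak_gain_le_best.
have S1P : S1 mu (alpha, beta, nu) <->
   ~~ ((0 < c_lam alpha beta nu mu) &&
       (`|b_lam alpha beta nu mu| * (1 + c_lam alpha beta nu mu) <
          4 * c_lam alpha beta nu mu)).
  rewrite /S1 /= negb_and -!leNgt normrM.
  case: Smu => c1 _ _ _; rewrite (@ger0_norm _ (1 + _)); last by lra.
  have [c0|c0] := leP (c_lam alpha beta nu mu) 0; first by split=> // _; left.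
  by rewrite (gtr0_norm c0) /=; split=> [[h|//]|]; [lra | right].
have amu : alpha * mu = 1 + b_lam alpha beta nu mu + c_lam alpha beta nu mu.
  by rewrite /b_lam /c_lam; ring.
split=> [[_ Hb]|[s1 s2]].
  split; last by rewrite /S2 /= -gL -Hb Hg le_max lexx orbT.
  have gmu : g mu = best by apply/eqP; rewrite eq_le best_le andbT -Hb Hg le_max lexx.
  by apply/S1P; move/bestP: gmu; rewrite amu => /(char_min_modulus_eq1 Smu)[].
suff -> : H = best by [].
rewrite Hg; suff gmu : g mu = best by rewrite gmu; apply/max_idPl; rewrite gL.
apply/bestP; rewrite amu; apply/(char_min_modulus_eq1 Smu); split; last exact/S1P.
(* If b_mu > 0 then also b_L > 0, and evaluating at z = -1 gives
   r_L <= 1 + c_L - b_L <= 1 + c_mu - b_mu < alpha mu, against S2. *)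
rewrite leNgt; apply/negP => bmu.
move: s2; rewrite /S2 /=; apply/negP; rewrite -ltNge.
apply: le_lt_trans (char_min_modulus_leN1 SL) _.
apply: lt_le_trans (_ : alpha * mu <= _); last first.
  rewrite ler_pM2l // -{1}(@ger0_norm _ mu) ?(ltW mu_gt0) // -sqrtr_sqr ler_sqrt.
  by rewrite expr2 ler_pM2r // ltW.
  by rewrite ltW // mulr_gt0.
have aL : alpha * mu < alpha * L by rewrite ltr_pM2l.
have anL : alpha * mu * nu <= alpha * L * nu by rewrite ler_wpM2r // ltW.
by move: bmu; rewrite amu /b_lam /c_lam; lra.
Qed.
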